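(* Let $(E,C)$ be an adaptable separated graph. Then the tight groupoid $\mathcal G_{tight}(S(E,C))$ associated to the inverse semigroup $S(E,C)$ is Hausdorff.
   Context: **Adaptable separated graphs.** $\mathbb N=\{1,2,\dots\}$. For a directed graph $E=(E^0,E^1,s,r)$, paths are $e_1\cdots e_n$ with $r(e_i)=s(e_{i+1})$; vertices are paths of length $0$. A separated graph $(E,C)$ is a directed graph $E$ with $C=\bigsqcup_{v\in E^0}C_v$, where $C_v$ is a partition of $s^{-1}(v)$ into nonempty subsets ($C_v=\emptyset$ if $v$ is a sink). It is finitely separated if all sets in $C$ are finite. Put $v\le w$ if there is a path from $w$ to $v$; let $(I,\le)$ be the antisymmetrization of $(E^0,\le)$, whose elements are the transitive components. A finitely separated graph $(E,C)$ is adaptable if $I$ is finite and there are a partition $I=I_{free}\sqcup I_{reg}$ and subgraphs $(E_p)_{p\in I}$, with $E_p^0$ the vertex set of the component $p$, such that: (1) $E^0=\bigsqcup_p E_p^0$; $E_p$ is a transitive (any two vertices joined by a directed path) row-finite graph if $p\in I_{reg}$; $E_p^0=\{v^p\}$ if $p\in I_{free}$. (2) For $p\in I_{reg}$, $w\in E_p^0$: $|C_w|=1$, $|s_{E_p}^{-1}(w)|\ge 2$, and every edge with source $w$ lies in $E_p$ or has range in $E_q^0$ with $q<p$. (3) For $p\in I_{free}$: $s^{-1}(v^p)=\emptyset$ iff $p$ is minimal in $I$ (then put $k(p)=0$). If $p$ is not minimal, $C_{v^p}=\{X_1^{(p)},\dots,X_{k(p)}^{(p)}\}$ is finite with $X_i^{(p)}=\{\alpha(p,i),\beta(p,i,1),\dots,\beta(p,i,g(p,i))\}$,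 $g(p,i)\ge1$, $\alpha(p,i)$ a loop at $v^p$, $r(\beta(p,i,t))\in E_q^0$ with $q<p$; and $E_p^1=\{\alpha(p,1),\dots,\alpha(p,k(p))\}$. **The inverse semigroup $S(E,C)$.** It is the $*$-semigroup with $0$ ($*$-semigroup: $s^{**}=s$, $(st)^*=t^*s^*$) generated by $E^0\cup E^1\cup\{(t_i^v)^{\pm1}: i\in\mathbb N,v\in E^0\}$ with relations: (R1) $vw=\delta_{v,w}v$, $v^*=v$ for $v,w\in E^0$; (R2) $e=s(e)e=er(e)$ for $e\in E^1$, and $e^*f=\delta_{e,f}r(e)$ for $e,f$ in the same set $X\in C$; (R3) for $p\in I_{free}$, $i\ne j$: $\alpha(p,i)\alpha(p,j)=\alpha(p,j)\alpha(p,i)$, $\alpha(p,i)\alpha(p,j)^*=\alpha(p,j)^*\alpha(p,i)$; (R4) for $p\in I_{free}$: $\beta(p,i,s)^*\beta(p,j,t)=0$ if $(i,s)\neq(j,t)$; (R5) for each $v$ the elements $(t_i^v)^{\pm1}$ commute mutually, $vt_i^v=t_i^v=t_i^vv$, $t_i^v(t_i^v)^{-1}=v=(t_i^v)^{-1}t_i^v$, $(t_i^v)^*=(t_i^v)^{-1}$; (R6) $t_i^{s(e)}e=e\,t_i^{r(e)}$ if $s(e)\in E_p^0$, $p\in I_{reg}$; (R7) for $p\in I_{free}$: $(t_i^{v^p})^{\pm1}\beta(p,j,s)=\beta(p,j,s)(t^{r(\beta(p,j,s))}_{i+k(p)-1})^{\pm1}$; (R8) for $p\in I_{free}$, $i\ne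 j$: $\alpha(p,i)\beta(p,j,s)=\beta(p,j,s)t^{r(\beta(p,j,s))}_{\sigma_j^p(i)}$ and $\alpha(p,i)^*\beta(p,j,s)=\beta(p,j,s)(t^{r(\beta(p,j,s))}_{\sigma_j^p(i)})^{-1}$, where $\sigma_j^p$ is the increasing bijection $\{1,\dots,k(p)\}\setminus\{j\}\to\{1,\dots,k(p)-1\}$; (R9) for $p\in I_{free}$: $t_i^{v^p}$ commutes with $\alpha(p,j)$ and $\alpha(p,j)^*$. $S(E,C)$ is an inverse semigroup; $\mathcal E$ is its semilattice of idempotents ($e\le f$ iff $ef=e$). **Tight groupoid.** A filter on $\mathcal E$ is a nonempty $\eta\subseteq\mathcal E$ with $0\notin\eta$, closed under products and upward closed. Filters are topologized as a subspace of $\{0,1\}^{\mathcal E}$. A finite cover of $\mathcal F_e=\{f\in\mathcal E:f\le e\}$ is a finite $Z\subseteq\mathcal F_e$ such that every $0\ne f\in\mathcal F_e$ has $fz\neq0$ for some $z\in Z$. A filter $\eta$ is tight if $e\in\eta$ implies $Z\cap\eta\ne\emptyset$ for every finite cover $Z$ of $\mathcal F_e$; $\widehat{\mathcal E}_{tight}$ is the space of tight filters. For $e\in\mathcal E$ let $D_e=\{\eta\in\widehat{\mathcal E}_{tight}: e\in\eta\}$; $s\in S(E,C)$ acts by $\alpha_s\colon D_{s^*s}\to D_{ss^*}$, $\alpha_s(\eta)=\{f\in\mathcal E: s^*fs\in\eta\}$. $\mathcal G_{tight}(S(E,C))$ is the groupoid of germs $[s,x]$, $x\in D_{s^*s}$,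 where $[s,x]=[s',y]$ iff $x=y$ and $sf=s'f$ for some $f\in\mathcal E$ with $f\in x$; source $x$, range $\alpha_s(x)$, $[s,\alpha_t(x)][t,x]=[st,x]$, $[s,x]^{-1}=[s^*,\alpha_s(x)]$. Its topology is generated by $\Theta(s,U)=\{[s,x]:x\in U\}$, $U\subseteq D_{s^*s}$ open. *)

(* Defs.v *)
From HB Require Import structures.
From mathcomp Require Import all_boot all_classical.
From mathcomp Require Import topology.

Set Implicit Arguments.
Unset Strict Implicit.
Unset Printing Implicit Defensive.

Local Open Scope classical_set_scope.
Local Open Scope card_scope.

(** The set of classes [R x] of a relation [R]; it is the quotient of [T] by [R]
    when [R] is an equivalence. *)
Definition classes (T : Type) (R : T -> set T) : Type := set_type (range R).

Definition class_of (T : Type) (R : T -> set T) (x : T) : classes R :=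
  exist _ (R x) (mem_set (imageT R x)).

Lemma class_of_surj (T : Type) (R : T -> set T) (c : classes R) :
  exists x, class_of R x = c.
Proof.
by case: c => A hA; have [x _ xA] := set_mem hA; exists x; exact: val_inj.
Qed.

Definition class_repr (T : Type) (R : T -> set T) (c : classes R) : T :=
  sval (cid (class_of_surj c)).

Lemma class_reprK (T : Type) (R : T -> set T) (c : classes R) :
  class_of R (class_repr c) = c.
Proof. exact: svalP (cid (class_of_surj c)). Qed.

Lemma class_ofP (T : Type) (R : T -> set T) :
    (forall x, R x x) -> (forall x y, R x y -> R y x) ->
    (forall x y z, R x y -> R y z -> R x z) ->
  forall x y, class_of R x = class_of R y <-> R x y.
Proof.
move=> Rxx RC RT x y; split=> [/(congr1 val) /= -> //|Rxy].
apply: val_inj; apply/seteqP; split=> z /=; last exact: RT.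
by apply: RT; exact: RC.
Qed.

(** * Separated graphs *)

Record digraph := Digraph {
  vertex : Type;
  edge : Type;
  src : edge -> vertex;
  tgt : edge -> vertex }.

(** [is_path A v s w]: [s] is a path from [v] to [w] with all its edges in [A]. *)
Fixpoint is_path (G : digraph) (A : set (edge G)) (v : vertex G)
    (s : seq (edge G)) (w : vertex G) : Prop :=
  match s with
  | [::] => v = w
  | e :: s' => [/\ A e, src e = v & is_path A (tgt e) s' w]
  end.

Definition joined (G : digraph) (A : set (edge G)) (v w : vertex G) : Prop :=
  exists s, is_path A v s w.

Definition vertex_le (G : digraph) (v w : vertex G) : Prop := joined setT w v.

Definition vertex_eqv (G : digraph) (v : vertex G) : set (vertex G) :=
  [set w | vertex_le v w /\ vertex_le w v].

Definition component (G : digraph) : Type := classes (@vertex_eqv G).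

Definition comp_of (G : digraph) (v : vertex G) : component G :=
  class_of (@vertex_eqv G) v.

Definition comp_vertices (G : digraph) (p : component G) : set (vertex G) :=
  [set v | comp_of v = p].

Definition comp_le (G : digraph) (p q : component G) : Prop :=
  exists v w, [/\ comp_of v = p, comp_of w = q & vertex_le v w].

Definition comp_lt (G : digraph) (p q : component G) : Prop :=
  comp_le p q /\ p <> q.

Definition comp_minimal (G : digraph) (p : component G) : Prop :=
  ~ exists q, comp_lt q p.

Definition out_edges (G : digraph) (v : vertex G) : set (edge G) :=
  [set e | src e = v].

(** [sep v] is the family C_v; the indexed partition of the library is used with
    the sets in C_v indexed by themselves. *)
Record separated_graph := SeparatedGraph {
  sg_graph :> digraph;
  sep : vertex sg_graph -> set (set (edge sg_graph));
  sep_partition : forall v, partition (sep v) id (out_edges v) }.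

(** I_reg is the complement of [free].  The indices i and (i, t) of
    alpha(p,i) and beta(p,i,t) start at 0.  The values of [base], [nblocks],
    [nbeta], [alpha] and [beta] at a component which is not free are unused. *)
Record adaptable (G : separated_graph) := Adaptable {
  free : set (component G);
  sub_edges : component G -> set (edge G);
  base : component G -> vertex G;
  nblocks : component G -> nat;
  nbeta : forall p, 'I_(nblocks p) -> nat;
  alpha : forall p, 'I_(nblocks p) -> edge G;
  beta : forall p (i : 'I_(nblocks p)), 'I_(nbeta i) -> edge G;

  sep_finite : forall (v : vertex G) X, sep v X -> finite_set X;
  comp_finite : finite_set [set: component G];
  sub_edgesP : forall p e, sub_edges p e ->
    comp_vertices p (src e) /\ comp_vertices p (tgt e);

  reg_transitive : forall p v w, ~ free p ->
    comp_vertices p v -> comp_vertices p w -> joined (sub_edges p) v w;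
  reg_row_finite : forall p v, ~ free p -> comp_vertices p v ->
    finite_set (sub_edges p `&` out_edges v);
  reg_sep : forall p v, ~ free p -> comp_vertices p v -> sep v #= `I_1;
  reg_two_edges : forall p v, ~ free p -> comp_vertices p v ->
    `I_2 #<= sub_edges p `&` out_edges v;
  reg_edges : forall p e, ~ free p -> comp_vertices p (src e) ->
    sub_edges p e \/ comp_lt (comp_of (tgt e)) p;

  free_vertex : forall p, free p -> comp_vertices p = [set base p];
  free_sink : forall p, free p ->
    (out_edges (base p) = set0 <-> comp_minimal p);
  free_min_nblocks : forall p, free p -> comp_minimal p -> nblocks p = 0%N;
  free_sep : forall p, free p -> ~ comp_minimal p ->
    sep (base p) = [set alpha i |` range (@beta p i) | i in [set: 'I_(nblocks p)]];
  free_sep_inj : forall p, free p -> ~ comp_minimal p ->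
    injective (fun i : 'I_(nblocks p) => alpha i |` range (@beta p i));
  free_beta_inj : forall p (i : 'I_(nblocks p)), free p -> ~ comp_minimal p ->
    injective (@beta p i);
  free_nbeta : forall p (i : 'I_(nblocks p)), free p -> ~ comp_minimal p ->
    (1 <= nbeta i)%N;
  free_alpha_loop : forall p (i : 'I_(nblocks p)), free p -> ~ comp_minimal p ->
    src (alpha i) = base p /\ tgt (alpha i) = base p;
  free_beta_tgt : forall p (i : 'I_(nblocks p)) (t : 'I_(nbeta i)),
    free p -> ~ comp_minimal p -> comp_lt (comp_of (tgt (beta t))) p;
  free_sub_edges : forall p, free p -> ~ comp_minimal p ->
    sub_edges p = range (@alpha p) }.

(** * The inverse semigroup of an adaptable separated graph *)

(** Terms over the signature of *-semigroups with zero.  [Tt v i] and [Ttinv v i]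
    stand for t_(i+1)^v and its inverse: the index of t starts at 0. *)
Inductive term (G : digraph) : Type :=
| Tzero
| Tvertex of vertex G
| Tedge of edge G
| Tt of vertex G & nat
| Ttinv of vertex G & nat
| Tmul of term G & term G
| Tstar of term G.

Arguments Tzero {G}.

Declare Scope term_scope.
Delimit Scope term_scope with term.
Bind Scope term_scope with term.
Notation "0" := Tzero : term_scope.
Notation "a * b" := (Tmul a b) : term_scope.
Notation "a ^*" := (Tstar a) : term_scope.

Definition Ttpm (G : digraph) (inv : bool) (v : vertex G) (i : nat) : term G :=
  if inv then Ttinv v i else Tt v i.

Section Semigroup.
Variables (G : separated_graph) (A : adaptable G).

Local Notation V := (@Tvertex G).
Local Notation E := (@Tedge G).
Local Notation T := (@Tt G).
Local Notation Tinv := (@Ttinv G).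
Local Notation Tpm := (@Ttpm G).
Local Notation alpha := (@alpha G A _).
Local Notation beta := (@beta G A _ _).

Local Open Scope term_scope.

(** With indices starting at 0, t_(i+k(p)-1) in [R7] is still obtained by adding
    k(p)-1 to the index (k(p) is positive as soon as beta(p,j,s) exists), and
    the increasing bijection sigma_j^p in [R8_alpha] and [R8_star] is [unbump j]. *)
Inductive sg_rel : term G -> term G -> Prop :=
| R1_idem v : sg_rel (V v * V v) (V v)
| R1_orth v w : v <> w -> sg_rel (V v * V w) 0
| R1_star v : sg_rel ((V v)^*) (V v)
| R2_src e : sg_rel (V (src e) * E e) (E e)
| R2_tgt e : sg_rel (E e * V (tgt e)) (E e)
| R2_eq v X e : sep v X -> X e -> sg_rel ((E e)^* * E e) (V (tgt e))
| R2_neq v X e f : sep v X -> X e -> X f -> e <> f -> sg_rel ((E e)^* * E f) 0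
| R3_comm p (i j : 'I_(nblocks A p)) : free A p -> i <> j ->
    sg_rel (E (alpha i) * E (alpha j)) (E (alpha j) * E (alpha i))
| R3_star p (i j : 'I_(nblocks A p)) : free A p -> i <> j ->
    sg_rel (E (alpha i) * (E (alpha j))^*) ((E (alpha j))^* * E (alpha i))
| R4 p (i j : 'I_(nblocks A p)) (s : 'I_(nbeta i)) (t : 'I_(nbeta j)) :
    free A p -> (i : nat, s : nat) <> (j : nat, t : nat) ->
    sg_rel ((E (beta s))^* * E (beta t)) 0
| R5_comm v i j (a b : bool) :
    sg_rel (Tpm a v i * Tpm b v j) (Tpm b v j * Tpm a v i)
| R5_left v i : sg_rel (V v * T v i) (T v i)
| R5_right v i : sg_rel (T v i * V v) (T v i)
| R5_mulV v i : sg_rel (T v i * Tinv v i) (V v)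
| R5_Vmul v i : sg_rel (Tinv v i * T v i) (V v)
| R5_star v i : sg_rel ((T v i)^*) (Tinv v i)
| R6 e i : ~ free A (comp_of (src e)) ->
    sg_rel (T (src e) i * E e) (E e * T (tgt e) i)
| R7 p (j : 'I_(nblocks A p)) (s : 'I_(nbeta j)) i (a : bool) : free A p ->
    sg_rel (Tpm a (base A p) i * E (beta s))
           (E (beta s) * Tpm a (tgt (beta s)) (i + (nblocks A p).-1))
| R8_alpha p (i j : 'I_(nblocks A p)) (s : 'I_(nbeta j)) : free A p -> i <> j ->
    sg_rel (E (alpha i) * E (beta s))
           (E (beta s) * T (tgt (beta s)) (unbump j i))
| R8_star p (i j : 'I_(nblocks A p)) (s : 'I_(nbeta j)) : free A p -> i <> j ->
    sg_rel ((E (alpha i))^* * E (beta s))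
           (E (beta s) * Tinv (tgt (beta s)) (unbump j i))
| R9 p i (j : 'I_(nblocks A p)) : free A p ->
    sg_rel (T (base A p) i * E (alpha j)) (E (alpha j) * T (base A p) i)
| R9_star p i (j : 'I_(nblocks A p)) : free A p ->
    sg_rel (T (base A p) i * (E (alpha j))^*) ((E (alpha j))^* * T (base A p) i).

(** The least congruence containing [sg_rel] whose quotient is a *-semigroup
    with zero. *)
Inductive sg_cong : term G -> term G -> Prop :=
| cong_rel a b : sg_rel a b -> sg_cong a b
| cong_refl a : sg_cong a a
| cong_sym a b : sg_cong a b -> sg_cong b a
| cong_trans a b c : sg_cong a b -> sg_cong b c -> sg_cong a c
| cong_mul a a' b b' : sg_cong a a' -> sg_cong b b' -> sg_cong (a * b) (a' * b')
| cong_star a b : sg_cong a b -> sg_cong (a^*) (b^*)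
| cong_mulA a b c : sg_cong (a * (b * c)) (a * b * c)
| cong_starK a : sg_cong ((a^*)^*) a
| cong_starM a b : sg_cong ((a * b)^*) (b^* * a^*)
| cong_mul0 a : sg_cong (0 * a) 0
| cong_mulr0 a : sg_cong (a * 0) 0.

Local Close Scope term_scope.

Definition sgroup : Type := classes sg_cong.

Definition sg_class (a : term G) : sgroup := class_of sg_cong a.

Definition sg_zero : sgroup := sg_class Tzero.

Definition sg_mul (x y : sgroup) : sgroup :=
  sg_class (Tmul (class_repr x) (class_repr y)).

Definition sg_star (x : sgroup) : sgroup := sg_class (Tstar (class_repr x)).

Lemma sg_classP a b : sg_class a = sg_class b <-> sg_cong a b.
Proof.
exact: (class_ofP cong_refl cong_sym cong_trans).
Qed.

Lemma sg_cong_repr a : sg_cong (class_repr (sg_class a)) a.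
Proof. by apply/sg_classP; exact: class_reprK. Qed.

Lemma sg_mulE a b : sg_mul (sg_class a) (sg_class b) = sg_class (Tmul a b).
Proof. by apply/sg_classP/cong_mul; exact: sg_cong_repr. Qed.

Lemma sg_starE a : sg_star (sg_class a) = sg_class (Tstar a).
Proof. by apply/sg_classP/cong_star; exact: sg_cong_repr. Qed.

End Semigroup.

Declare Scope sgroup_scope.
Delimit Scope sgroup_scope with sg.
Bind Scope sgroup_scope with sgroup.
Notation "0" := (sg_zero _) : sgroup_scope.
Notation "x * y" := (sg_mul x y) : sgroup_scope.
Notation "x ^*" := (sg_star x) : sgroup_scope.

(** * The tight groupoid *)

Section TightGroupoid.
Variables (G : separated_graph) (A : adaptable G).
Local Open Scope sgroup_scope.
Local Notation S := (sgroup A).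

Definition idempotents : set S := [set e | e * e = e].

Definition idem_le (e f : S) : Prop := e * f = e.

(** Filters on the semilattice of idempotents are sets of elements of the
    semigroup contained in [idempotents]. *)
Definition is_filter (eta : set S) : Prop :=
  [/\ eta `<=` idempotents, eta !=set0, ~ eta 0,
      forall e f, eta e -> eta f -> eta (e * f) &
      forall e f, eta e -> idempotents f -> idem_le e f -> eta f].

Definition idem_below (e : S) : set S :=
  [set f | idempotents f /\ idem_le f e].

Definition finite_cover (e : S) (Z : set S) : Prop :=
  [/\ finite_set Z, Z `<=` idem_below e &
      forall f, idem_below e f -> f <> 0 -> exists2 z, Z z & f * z <> 0].

Definition tight_filters : set (set S) :=
  [set eta | is_filter eta /\
    forall e Z, eta e -> finite_cover e Z -> (Z `&` eta) !=set0].

Definition tight_spectrum : Type := set_type tight_filters.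

HB.instance Definition _ := Choice.on tight_spectrum.

(** The inclusion of the tight filters into {0,1}^idempotents. *)
Definition filter_char (eta : tight_spectrum) :
    {ptws set_type idempotents -> bool} :=
  fun e => `[< val eta (val e) >].

HB.instance Definition _ :=
  Topological.copy tight_spectrum (initial_topology filter_char).

Definition tight_dom (e : S) : set tight_spectrum := [set x | val x e].

Definition tight_act (s : S) (eta : set S) : set S :=
  [set f | idempotents f /\ eta (s^* * f * s)].

Definition germ_pairs : set (S * tight_spectrum) :=
  [set a | tight_dom (a.1^* * a.1) a.2].

Definition same_germ (a b : S * tight_spectrum) : Prop :=
  a.2 = b.2 /\ exists2 f, idempotents f /\ val a.2 f & a.1 * f = b.1 * f.

(** The germ [s, x] is the class of (s, x) for [same_germ] in [germ_pairs]. *)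
Definition germ (s : S) (x : tight_spectrum) : set (S * tight_spectrum) :=
  [set b | germ_pairs b /\ same_germ (s, x) b].

Definition tight_groupoid : Type :=
  set_type [set germ a.1 a.2 | a in germ_pairs].

(** The structure maps of the groupoid are given as relations: that they are
    well-defined functions rests on the semigroup being inverse.  The topology
    does not depend on them. *)
Definition groupoid_source (g : tight_groupoid) (x : tight_spectrum) : Prop :=
  exists2 s, germ_pairs (s, x) & val g = germ s x.

Definition groupoid_range (g : tight_groupoid) (y : tight_spectrum) : Prop :=
  exists s x, [/\ germ_pairs (s, x), val g = germ s x & val y = tight_act s (val x)].

Definition groupoid_mul (g h k : tight_groupoid) : Prop :=
  exists s t x y, [/\ germ_pairs (s, y) /\ germ_pairs (t, x),
    val y = tight_act t (val x),
    val g = germ s y, val h = germ t x & val k = germ (s * t) x].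

Definition groupoid_inv (g h : tight_groupoid) : Prop :=
  exists s x y, [/\ germ_pairs (s, x), val y = tight_act s (val x),
    val g = germ s x & val h = germ (s^*) y].

Definition Theta (s : S) (U : set tight_spectrum) : set tight_groupoid :=
  [set g | exists2 x, U x & val g = germ s x].

Definition Theta_sets : set (set tight_groupoid) :=
  [set W | exists s U,
    [/\ open U, U `<=` tight_dom (s^* * s) & W = Theta s U]].

HB.instance Definition _ := Choice.on tight_groupoid.

HB.instance Definition _ :=
  @isSubBaseTopological.Build tight_groupoid (set tight_groupoid) Theta_sets id.

End TightGroupoid.

(* Main.v *)
Require Import Defs.
From mathcomp Require Import all_boot all_classical topology.
From mathcomp Require Import order ssralg ssrnum ssrint.

Set Implicit Arguments.
Unset Strict Implicit.
Unset Printing Implicit Defensive.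

Local Open Scope classical_set_scope.

(** S = S(E,C) is an E*-unitary inverse semigroup, which forces the groupoid to be
    Hausdorff: if the germs of s and t agree at one point, then the element t^* s is
    above a nonzero idempotent, hence is idempotent, and the germs of s and t agree
    at x exactly when x belongs to the clopen set of filters containing t^* s.

    Let a word be a product of vertices, edges and t_i^{+-1}.  For letters x, y with
    the same source, x^* y is zero or y' x'^* with letters x', y' such that
    x y' = y x'; hence every element of S is zero or p q^* with words p, q, and S is
    inverse.

    For E*-unitarity, the nonzero elements of S are graded by a group of bijections
    of Z^I: t_i and alpha(p,i) are translations along the axes, while beta(p,j,s)
    permutes the axes so as to match (alpha(p,i))_{i <> j}, (t_i)_i at its source with
    (t_i)_i at its range.  If p q^* lies above a nonzero idempotent, then p and q have
    the same degree and q^* p is nonzero.  Moving the t's and the alpha's as far to the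
    right as possible gives normal forms of p and q; they are products of equally
    many steps, the steps coincide by the orthogonality relations, and the remaining
    commuting letters are read off the degree.  Thus p = q. *)

(** * Semigroup laws and structure of the graph *)

Section SemigroupLaws.
Variables (G : separated_graph) (A : adaptable G).
Local Notation S := (sgroup A).
Local Open Scope sgroup_scope.
Implicit Types (x y z : S) (u v w : vertex G) (e f : edge G).

Lemma sg_classS x : exists a, x = sg_class A a.
Proof. by exists (class_repr x); rewrite /sg_class class_reprK. Qed.

Lemma sg_mulA x y z : x * (y * z) = x * y * z.
Proof.
have [a ->] := sg_classS x; have [b ->] := sg_classS y; have [c ->] := sg_classS z.
by rewrite !sg_mulE; apply/sg_classP/cong_mulA.
Qed.

Lemma sg_starK x : x^*^* = x.
Proof.
by have [a ->] := sg_classS x; rewrite !sg_starE; apply/sg_classP/cong_starK.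
Qed.

Lemma sg_starM x y : (x * y)^* = y^* * x^*.
Proof.
have [a ->] := sg_classS x; have [b ->] := sg_classS y.
by rewrite !(sg_mulE, sg_starE); apply/sg_classP/cong_starM.
Qed.

Lemma sg_mul0 x : 0 * x = 0.
Proof.
by have [a ->] := sg_classS x; rewrite sg_mulE; apply/sg_classP/cong_mul0.
Qed.

Lemma sg_mulr0 x : x * 0 = 0.
Proof.
by have [a ->] := sg_classS x; rewrite sg_mulE; apply/sg_classP/cong_mulr0.
Qed.

Lemma sg_star0 : 0^* = 0 :> S.
Proof. by rewrite -[in LHS](sg_mul0 0^*) sg_starM sg_starK sg_mul0. Qed.

Lemma sg_mulKA x y z t : x * y = z -> x * (y * t) = z * t.
Proof. by move=> <-; rewrite sg_mulA. Qed.

Definition sv v : S := sg_class A (Tvertex v).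
Definition se e : S := sg_class A (Tedge e).
(** [st true v i] is the inverse of [st false v i]. *)
Definition st (b : bool) v i : S := sg_class A (Ttpm b v i).

Lemma sg_relE a b : sg_rel A a b -> sg_class A a = sg_class A b.
Proof. by move=> ab; apply/sg_classP/cong_rel. Qed.

Lemma se_starE e : (se e)^* = sg_class A (Tstar (Tedge e)).
Proof. by rewrite sg_starE. Qed.

Lemma sv_idem v : sv v * sv v = sv v.
Proof. by rewrite sg_mulE; apply/sg_relE/R1_idem. Qed.

Lemma sv_orth v w : v <> w -> sv v * sv w = 0.
Proof. by move=> vw; rewrite sg_mulE; apply/sg_relE/R1_orth. Qed.

Lemma sv_star v : (sv v)^* = sv v.
Proof. by rewrite sg_starE; apply/sg_relE/R1_star. Qed.

Lemma st_star b v i : (st b v i)^* = st (~~ b) v i.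
Proof.
have st_star_false : (st false v i)^* = st true v i.
  by rewrite sg_starE; apply/sg_relE/R5_star.
by case: b => //=; rewrite -st_star_false sg_starK.
Qed.

Lemma st_src b v i : sv v * st b v i = st b v i.
Proof.
case: b; last by rewrite sg_mulE; apply/sg_relE/R5_left.
rewrite -[st true v i]/(st (~~ false) v i) -st_star -[sv v]sv_star -sg_starM.
by congr (_^*); rewrite sg_mulE; apply/sg_relE/R5_right.
Qed.

Lemma st_tgt b v i : st b v i * sv v = st b v i.
Proof.
by rewrite -[LHS]sg_starK sg_starM sv_star st_star st_src st_star negbK.
Qed.

Lemma st_mulV b v i : st b v i * st (~~ b) v i = sv v.
Proof.
by case: b; rewrite sg_mulE; apply/sg_relE; [exact: R5_Vmul|exact: R5_mulV].
Qed.

Lemma st_comm a b v i j : st a v i * st b v j = st b v j * st a v i.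
Proof. by rewrite !sg_mulE; apply/sg_relE/R5_comm. Qed.

Lemma se_src e : sv (src e) * se e = se e.
Proof. by rewrite sg_mulE; apply/sg_relE/R2_src. Qed.

Lemma se_tgt e : se e * sv (tgt e) = se e.
Proof. by rewrite sg_mulE; apply/sg_relE/R2_tgt. Qed.

Lemma sep_src v X e : sep v X -> X e -> src e = v.
Proof.
move=> vX Xe; have [coverE _ _] := sep_partition v.
by suff : out_edges v e by []; rewrite -coverE; exists X.
Qed.

Lemma edge_sep e : exists2 X, sep (src e) X & X e.
Proof.
have [coverE _ _] := sep_partition (src e).
by have : out_edges (src e) e by []; rewrite -coverE => -[X]; exists X.
Qed.

Lemma se_iso e : (se e)^* * se e = sv (tgt e).
Proof.
have [X eX Xe] := edge_sep e.
by rewrite sg_starE sg_mulE; apply/sg_relE/(R2_eq _ eX).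
Qed.

Lemma se_orth v X e f : sep v X -> X e -> X f -> e <> f -> (se e)^* * se f = 0.
Proof.
by move=> vX Xe Xf ef; rewrite sg_starE sg_mulE; apply/sg_relE/(R2_neq _ vX).
Qed.

(** R6 and R9 are imposed on t only; multiplying by the inverses on both sides turns a commutation
    rule for t into one for its inverse. *)
Lemma st_pushV b v w i j x : sv v * x = x -> x * sv w = x ->
  st b v i * x = x * st b w j -> st (~~ b) v i * x = x * st (~~ b) w j.
Proof.
move=> vx xw tx; rewrite -[in LHS]xw -(st_mulV b w j) (sg_mulA x) -tx.
have tV := st_mulV (~~ b) v i; rewrite negbK in tV.
by rewrite !sg_mulA tV vx.
Qed.

(** * Blocks at free vertices and the three kinds of edges *)

Lemma comp_of_base p : free A p -> comp_of (base A p) = p.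
Proof.
by move=> /free_vertex pE; suff : comp_vertices p (base A p) by []; rewrite pE.
Qed.

(** The axioms on the blocks of a free component assume that it is not minimal; a minimal one has no
    index at all. *)
Lemma free_not_minimal p : free A p -> 'I_(nblocks A p) -> ~ comp_minimal p.
Proof. by move=> fp i mp; case: i => m; rewrite (free_min_nblocks fp mp). Qed.

Definition block p (i : 'I_(nblocks A p)) : set (edge G) :=
  alpha i |` range (@beta _ A p i).

Lemma sep_block p i : free A p -> sep (base A p) (@block p i).
Proof.
by move=> fp; rewrite (free_sep fp (free_not_minimal fp i)); exists i.
Qed.

(** The sets in C_v are disjoint, and distinct indices give distinct sets. *)
Lemma block_inj p e (i j : 'I_(nblocks A p)) : free A p ->
  block i e -> block j e -> i = j.
Proof.
move=> fp ie je; apply: (free_sep_inj fp (free_not_minimal fp i)).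
have [_ /(_ _ _ (sep_block i fp) (sep_block j fp)) tI _] :=
  sep_partition (base A p).
by apply: tI; exists e.
Qed.

Lemma block_alpha p (i : 'I_(nblocks A p)) : block i (alpha i).
Proof. by left. Qed.

Lemma block_beta p (i : 'I_(nblocks A p)) (t : 'I_(nbeta i)) : block i (beta t).
Proof. by right; exists t. Qed.
Hint Resolve block_alpha block_beta : core.

Lemma src_alpha p (i : 'I_(nblocks A p)) : free A p -> src (alpha i) = base A p.
Proof. by move=> fp; apply: sep_src (sep_block i fp) _. Qed.

Lemma src_beta p (i : 'I_(nblocks A p)) (t : 'I_(nbeta i)) : free A p ->
  src (beta t) = base A p.
Proof. by move=> fp; apply: sep_src (sep_block i fp) _. Qed.

Lemma tgt_alpha p (i : 'I_(nblocks A p)) : free A p -> tgt (alpha i) = base A p.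
Proof.
by move=> fp; have [] := free_alpha_loop i fp (free_not_minimal fp i).
Qed.

Lemma alpha_inj p (i j : 'I_(nblocks A p)) : free A p -> alpha i = alpha j -> i = j.
Proof.
by move=> fp ij; apply: (block_inj fp (block_alpha i)); rewrite ij.
Qed.

Lemma beta_block_inj p (i j : 'I_(nblocks A p)) (s : 'I_(nbeta i))
  (t : 'I_(nbeta j)) : free A p -> beta s = beta t -> i = j.
Proof.
by move=> fp st; apply: (block_inj fp (block_beta s)); rewrite st.
Qed.

(** The two edges end in different components: a loop stays in p, a beta falls strictly below p. *)
Lemma alpha_neq_beta p (i j : 'I_(nblocks A p)) (t : 'I_(nbeta j)) : free A p ->
  alpha i <> beta t.
Proof.
move=> fp ab; have [_] := free_beta_tgt t fp (free_not_minimal fp i).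
by apply; rewrite -ab tgt_alpha// comp_of_base.
Qed.

Variant edge_spec e : Prop :=
| EdgeReg of ~ free A (comp_of (src e))
| EdgeAlpha p (i : 'I_(nblocks A p)) of free A p & e = alpha i
| EdgeBeta p (i : 'I_(nblocks A p)) (t : 'I_(nbeta i)) of free A p & e = beta t.

Lemma edgeP e : edge_spec e.
Proof.
have [fp|] := pselect (free A (comp_of (src e))); last exact: EdgeReg.
have srcE : src e = base A (comp_of (src e)).
  by have : comp_vertices (comp_of (src e)) (src e) by []; rewrite (free_vertex fp).
(* The base vertex of a minimal free component is a sink, but e leaves it. *)
have nmin : ~ comp_minimal (comp_of (src e)).
  by move=> /(free_sink fp) out0; suff : out_edges (base A (comp_of (src e))) e
    by rewrite out0.
have [X] := edge_sep e; rewrite {1}srcE (free_sep fp nmin) => -[i _ <-].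
by case=> [ei|[t _ te]]; [exact: EdgeAlpha fp ei|exact: EdgeBeta fp (esym te)].
Qed.

(** At a regular vertex C_v has only one element, so e and f lie in the same set and R2 applies. *)
Lemma reg_edge_orth e f : ~ free A (comp_of (src e)) -> src e = src f -> e <> f ->
  (se e)^* * se f = 0.
Proof.
move=> re ef; have [X eX Xe] := edge_sep e; have [Y] := edge_sep f.
rewrite -ef => eY Yf; apply: (se_orth eX Xe).
suff -> : X = Y by [].
have /card_set_bijP[g [gI ginj _]] := reg_sep re (erefl : comp_vertices _ (src e)).
apply: ginj; [exact: mem_set|exact: mem_set|].
by have := gI _ eX; have := gI _ eY; rewrite /= !ltnS !leqn0 => /eqP -> /eqP ->.
Qed.

End SemigroupLaws.

(** * S(E,C) is an inverse semigroup *)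

Section InverseSemigroup.
Variables (G : separated_graph) (A : adaptable G).
Local Notation S := (sgroup A).
Local Notation sv := (@sv G A).
Local Notation se := (@se G A).
Local Notation st := (@st G A).
Local Open Scope sgroup_scope.
Implicit Types (x y z : S) (u v w : vertex G) (e f : edge G).
Hint Resolve block_alpha block_beta : core.

Lemma alpha_iso p (i : 'I_(nblocks A p)) : free A p ->
  (se (alpha i))^* * se (alpha i) = sv (base A p).
Proof. by move=> fp; rewrite se_iso tgt_alpha. Qed.

Lemma alpha_comm p (i j : 'I_(nblocks A p)) : free A p ->
  se (alpha i) * se (alpha j) = se (alpha j) * se (alpha i).
Proof.
move=> fp; have [->//|/eqP ij] := eqVneq i j.
by rewrite !sg_mulE; apply/sg_relE/R3_comm.
Qed.

Lemma alpha_star_comm p (i j : 'I_(nblocks A p)) : free A p -> i <> j ->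
  (se (alpha i))^* * se (alpha j) = se (alpha j) * (se (alpha i))^*.
Proof.
move=> fp ij; rewrite se_starE !sg_mulE.
by apply/esym/sg_relE; apply: R3_star => // ji; apply: ij.
Qed.

Lemma alpha_beta p (i j : 'I_(nblocks A p)) (s : 'I_(nbeta j)) : free A p ->
  i <> j -> se (alpha i) * se (beta s) =
            se (beta s) * st false (tgt (beta s)) (unbump j i).
Proof. by move=> fp ij; rewrite !sg_mulE; apply/sg_relE/R8_alpha. Qed.

Lemma alpha_star_beta p (i j : 'I_(nblocks A p)) (s : 'I_(nbeta j)) : free A p ->
  i <> j -> (se (alpha i))^* * se (beta s) =
            se (beta s) * st true (tgt (beta s)) (unbump j i).
Proof. by move=> fp ij; rewrite se_starE !sg_mulE; apply/sg_relE/R8_star. Qed.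

Lemma alpha_beta_orth p (i : 'I_(nblocks A p)) (s : 'I_(nbeta i)) : free A p ->
  (se (alpha i))^* * se (beta s) = 0.
Proof.
move=> fp; apply: (se_orth A (sep_block i fp)) => //.
exact: alpha_neq_beta.
Qed.

Lemma beta_orth p (i j : 'I_(nblocks A p)) (s : 'I_(nbeta i)) (t : 'I_(nbeta j)) :
  free A p -> (i : nat, s : nat) <> (j : nat, t : nat) ->
  (se (beta s))^* * se (beta t) = 0.
Proof. by move=> fp ijst; rewrite se_starE sg_mulE; apply/sg_relE/R4. Qed.

Lemma st_beta b p (j : 'I_(nblocks A p)) (s : 'I_(nbeta j)) i : free A p ->
  st b (base A p) i * se (beta s) =
  se (beta s) * st b (tgt (beta s)) (i + (nblocks A p).-1).
Proof. by move=> fp; rewrite !sg_mulE; apply/sg_relE/R7. Qed.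

Lemma st_alpha b p (j : 'I_(nblocks A p)) i : free A p ->
  st b (base A p) i * se (alpha j) = se (alpha j) * st b (base A p) i.
Proof.
move=> fp; have st_alpha_false :
    st false (base A p) i * se (alpha j) = se (alpha j) * st false (base A p) i.
  by rewrite !sg_mulE; apply/sg_relE/R9.
case: b => //; apply: (st_pushV (b := false)) => //.
  by rewrite -(src_alpha j fp) se_src.
by rewrite -(tgt_alpha j fp) se_tgt.
Qed.

Lemma st_reg b e i : ~ free A (comp_of (src e)) ->
  st b (src e) i * se e = se e * st b (tgt e) i.
Proof.
move=> re; have st_reg_false :
    st false (src e) i * se e = se e * st false (tgt e) i.
  by rewrite !sg_mulE; apply/sg_relE/R6.
by case: b => //; apply: (st_pushV (b := false)); rewrite ?se_src ?se_tgt.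
Qed.

(** * Letters and their exchange rules *)

Inductive letter : vertex G -> vertex G -> S -> Prop :=
| letter_vertex v : letter v v (sv v)
| letter_edge e : letter (src e) (tgt e) (se e)
| letter_t b v i : letter v v (st b v i).

Lemma letter_src u v x : letter u v x -> sv u * x = x.
Proof. by case=> *; rewrite ?sv_idem ?se_src ?st_src. Qed.

Lemma letter_tgt u v x : letter u v x -> x * sv v = x.
Proof. by case=> *; rewrite ?sv_idem ?se_tgt ?st_tgt. Qed.

Lemma letter_iso u v x : letter u v x -> x^* * x = sv v.
Proof.
case=> [w|e|b w i]; rewrite ?sv_star ?sv_idem ?se_iso// st_star.
by rewrite -{2}[b]negbK st_mulV.
Qed.

(** One index j serves t and its inverse, because an exchange involves both a letter and its star.
    The index changes only at a beta, by k(p)-1. *)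
Lemma letter_push u v x i : letter u v x ->
  exists j, forall b, st b u i * x = x * st b v j.
Proof.
case=> [w|e|c w k].
- by exists i => b; rewrite st_src st_tgt.
- have [re|p j fp ->|p j s fp ->] := edgeP A e.
  + by exists i => b; rewrite st_reg.
  + by exists i => b; rewrite src_alpha// tgt_alpha// st_alpha.
  + by exists (i + (nblocks A p).-1) => b; rewrite src_beta// st_beta.
- by exists i => b; rewrite st_comm.
Qed.

(** The equation [x y' = y x'] is what makes the projections [p p^*] commute. *)
Definition exchange (P : vertex G -> vertex G -> S -> Prop) u v w x y : Prop :=
  x^* * y = 0 \/ exists a x' y',
    [/\ letter w a x', P v a y', x^* * y = y' * x'^* & x * y' = y * x'].

Lemma exchange_sym u v w x y : exchange letter u v w x y -> exchange letter u w v y x.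
Proof.
have starE : y^* * x = (x^* * y)^* by rewrite sg_starM sg_starK.
case=> [xy0|[a [x' [y' [lx ly xy xyE]]]]]; [left|right].
  by rewrite starE xy0 sg_star0.
by exists a, y', x'; split=> //; rewrite starE xy sg_starM sg_starK.
Qed.

Lemma letter_alpha p (i : 'I_(nblocks A p)) : free A p ->
  letter (base A p) (base A p) (se (alpha i)).
Proof.
by move=> fp; have := letter_edge (alpha i); rewrite src_alpha// tgt_alpha.
Qed.

Lemma letter_beta p (i : 'I_(nblocks A p)) (t : 'I_(nbeta i)) : free A p ->
  letter (base A p) (tgt (beta t)) (se (beta t)).
Proof. by move=> fp; have := letter_edge (beta t); rewrite src_beta. Qed.

Lemma exchange_alpha_beta p (i j : 'I_(nblocks A p)) (t : 'I_(nbeta j)) : free A p ->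
  exchange letter (base A p) (base A p) (tgt (beta t)) (se (alpha i)) (se (beta t)).
Proof.
move=> fp; have [ij|/eqP ij] := eqVneq i j.
  by left; move: t; rewrite -ij => t; exact: alpha_beta_orth.
right; exists (tgt (beta t)), (st false (tgt (beta t)) (unbump j i)), (se (beta t)).
split; [exact: letter_t|exact: letter_beta| |exact: alpha_beta].
by rewrite st_star alpha_star_beta.
Qed.

Lemma beta_orth_neq p (i j : 'I_(nblocks A p)) (s : 'I_(nbeta i)) (t : 'I_(nbeta j)) :
  free A p -> beta s <> beta t -> (se (beta s))^* * se (beta t) = 0.
Proof.
move=> fp st; apply: beta_orth => // -[ij]; apply: contra_not st.
move/val_inj: ij t => <- t st; congr beta; exact: val_inj.
Qed.

(** Distinct edges with a common source are orthogonal, with two exceptions: two alphas, which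
    commute by R3, and an alpha with a beta of another block, where R8 turns the alpha into a t. *)
Lemma exchange_edges e f : src e = src f ->
  exchange letter (src e) (tgt e) (tgt f) (se e) (se f).
Proof.
move=> ef.
have [<-|nef] := pselect (e = f).
  right; exists (tgt e), (sv (tgt e)), (sv (tgt e)).
  by rewrite sv_star se_iso sv_idem; split=> //; exact: letter_vertex.
have [re|p i fp eE|p i s fp eE] := edgeP A e.
- by left; exact: reg_edge_orth.
- move: ef nef; rewrite eE src_alpha// tgt_alpha//.
  have [|q j fq ->|q j t fq ->] := edgeP A f.
  + by move=> + fE; rewrite -fE comp_of_base.
  + rewrite src_alpha// => /(congr1 (@comp_of G)); rewrite !comp_of_base// => pq.
    subst q => ij; right; rewrite tgt_alpha//.
    exists (base A p), (se (alpha i)), (se (alpha j)).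
    split; [exact: letter_alpha|exact: letter_alpha| |exact: alpha_comm].
    by apply: alpha_star_comm => // ij'; apply: ij; rewrite ij'.
  + rewrite src_beta// => /(congr1 (@comp_of G)); rewrite !comp_of_base// => pq.
    by subst q => _; exact: exchange_alpha_beta.
- move: ef nef; rewrite eE src_beta//.
  have [|q j fq ->|q j t fq ->] := edgeP A f.
  + by move=> + fE; rewrite -fE comp_of_base.
  + rewrite src_alpha// => /(congr1 (@comp_of G)); rewrite !comp_of_base// => pq.
    subst q => _; apply: exchange_sym; rewrite tgt_alpha//.
    exact: exchange_alpha_beta.
  + rewrite src_beta// => /(congr1 (@comp_of G)); rewrite !comp_of_base// => pq.
    by subst q => ij; left; exact: beta_orth_neq.
Qed.

Lemma exchange_vertex u w y : letter u w y -> exchange letter u u w (sv u) y.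
Proof.
move=> ly; right; exists w, (sv w), y; rewrite !sv_star (letter_src ly) (letter_tgt ly).
by split=> //; exact: letter_vertex.
Qed.

Lemma exchange_t b i u w y : letter u w y -> exchange letter u u w (st b u i) y.
Proof.
move=> ly; have [j push] := letter_push i ly.
right; exists w, (st b w j), y; rewrite !st_star !push.
by split=> //; exact: letter_t.
Qed.

Lemma exchange_letters u v w x y : letter u v x -> letter u w y ->
  exchange letter u v w x y.
Proof.
case=> [a|e|b a i]; [exact: exchange_vertex| |exact: exchange_t].
move E : (src e) => a ly; case: ly E => [c|f|b c i] E.
- by rewrite -E; apply/exchange_sym/exchange_vertex/letter_edge.
- by rewrite -E; exact: exchange_edges.
- by rewrite -E; apply/exchange_sym/exchange_t/letter_edge.
Qed.

(** * Words, and the form p q^* of the elements of S *)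

Inductive word : vertex G -> vertex G -> S -> Prop :=
| word_nil v : word v v (sv v)
| word_cons u v w x p : letter u v x -> word v w p -> word u w (x * p).

Lemma word_src u v p : word u v p -> sv u * p = p.
Proof.
by case=> [w|{}u w {}v x {}p lx _]; rewrite ?sv_idem// sg_mulA (letter_src lx).
Qed.

Lemma word_tgt u v p : word u v p -> p * sv v = p.
Proof.
by elim=> [w|{}u w {}v x {}p _ _ IH]; rewrite ?sv_idem// -sg_mulA IH.
Qed.

Lemma letter_word u v x : letter u v x -> word u v x.
Proof.
by move=> lx; rewrite -(letter_tgt lx); apply: word_cons lx (word_nil v).
Qed.

Lemma word_iso u v p : word u v p -> p^* * p = sv v.
Proof.
elim=> [w|{}u w {}v x {}p lx wp IH]; first by rewrite sv_star sv_idem.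
by rewrite sg_starM -sg_mulA (sg_mulKA _ (letter_iso lx)) (word_src wp) IH.
Qed.

(** Sliding x through a letter leaves a single letter x', which can then be slid through the next
    letter of p. *)
Lemma exchange_letter_word u v w x p : letter u v x -> word u w p ->
  exchange word u v w x p.
Proof.
move=> + wp; elim: wp v x => [a|a b c y q ly wq IH] v x lx.
  right; exists v, x, (sv v); split; rewrite ?(letter_tgt lx) ?(letter_src lx)//.
  - exact: word_nil.
  - by rewrite -{1}(letter_src lx) sg_starM sv_star -sg_mulA sv_idem
      -{1}(letter_tgt lx) sg_starM sv_star -sg_mulA -{1}[sv a]sv_star -sg_starM
      (letter_src lx).
have [xy0|[d [x' [y' [lx' ly' xyE xy]]]]] := exchange_letters lx ly.
  by left; rewrite sg_mulA xy0 sg_mul0.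
have [xq0|[d' [x2 [q' [lx2 wq' xqE xq]]]]] := IH _ _ lx'.
  by left; rewrite sg_mulA xyE -sg_mulA xq0 sg_mulr0.
right; exists d', x2, (y' * q'); split=> //.
- exact: word_cons ly' wq'.
- by rewrite sg_mulA xyE -sg_mulA xqE sg_mulA.
- by rewrite sg_mulA xy -sg_mulA xq sg_mulA.
Qed.

Lemma word_cat u v w p q : word u v p -> word v w q -> word u w (p * q).
Proof.
move=> wp; elim: wp w q => [a|a b c x r lx wr IH] w q wq; first by rewrite (word_src wq).
by rewrite -sg_mulA; apply: word_cons lx (IH _ _ wq).
Qed.

Lemma word_orth u v w a p q : word u v p -> word a w q -> u <> a -> p^* * q = 0.
Proof.
move=> wp wq ua; rewrite -(word_src wp) -(word_src wq) sg_starM sv_star -sg_mulA.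
by rewrite (sg_mulKA _ (sv_orth _ ua)) sg_mul0 sg_mulr0.
Qed.

Lemma word_mul_orth u v w a p q : word u v p -> word a w q -> v <> a -> p * q = 0.
Proof.
move=> wp wq va; rewrite -(word_tgt wp) -(word_src wq) -sg_mulA.
by rewrite (sg_mulKA _ (sv_orth _ va)) sg_mul0 sg_mulr0.
Qed.

Definition fraction x : Prop :=
  x = 0 \/ exists u v w p q, [/\ word u w p, word v w q & x = p * q^*].

Lemma fraction_letter u v x s : letter u v x -> fraction s -> fraction (x * s).
Proof.
move=> lx [->|[a [b [c [p [q [wp wq ->]]]]]]]; first by left; rewrite sg_mulr0.
have [va|va] := pselect (v = a).
  subst a; right; exists u, b, c, (x * p), q; rewrite sg_mulA; split=> //.
  exact: word_cons lx wp.
by left; rewrite sg_mulA (word_mul_orth (letter_word lx) wp va) sg_mul0.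
Qed.

(** The exchange turns x^* p into p' x'^*, and x' is absorbed by the denominator, which becomes q
    x'. *)
Lemma fraction_letter_star u v x s : letter u v x -> fraction s -> fraction (x^* * s).
Proof.
move=> lx [->|[a [b [c [p [q [wp wq ->]]]]]]]; first by left; rewrite sg_mulr0.
have [ua|ua] := pselect (u = a); last first.
  by left; rewrite sg_mulA (word_orth (letter_word lx) wp ua) sg_mul0.
subst a; rewrite sg_mulA.
have [->|[d [x' [p' [lx' wp' -> _]]]]] := exchange_letter_word lx wp.
  by left; rewrite sg_mul0.
right; exists v, b, d, p', (q * x'); split=> //.
  exact: word_cat wq (letter_word lx').
by rewrite sg_starM sg_mulA.
Qed.

Lemma sg_generated (P : S -> Prop) :
  P 0 -> (forall u v x, letter u v x -> P x) ->
  (forall x y, P x -> P y -> P (x * y)) -> (forall x, P x -> P x^*) ->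
  forall x, P x.
Proof.
move=> P0 Pl PM Ps x; have [a ->] := sg_classS x.
elim: a => [|v|e|v i|v i|a IHa b IHb|a IHa] //.
- exact: Pl (letter_vertex v).
- exact: Pl (letter_edge e).
- exact: Pl (letter_t false v i).
- exact: Pl (letter_t true v i).
- by rewrite -sg_mulE; exact: PM.
- by rewrite -sg_starE; exact: Ps.
Qed.

Lemma fractionP x : fraction x.
Proof.
(* Left multiplication by y^* is carried along so that the induction on y passes through stars and
   products. *)
have fractionM y : forall z, fraction z -> fraction (y * z) /\ fraction (y^* * z).
  elim/sg_generated: y => [z _|u v y ly z fz|y z IHy IHz t ft|y IHy z fz].
  - by rewrite sg_star0 sg_mul0; split; left.
  - by split; [exact: fraction_letter ly _|exact: fraction_letter_star ly _].
  - rewrite sg_starM -!sg_mulA; split; [have [/IHy[]] := IHz _ ft|] => //.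
    by have [_ /IHz[]] := IHy _ ft.
  - by rewrite sg_starK; have [] := IHy _ fz.
elim/sg_generated: x => [|u v x lx|x y _ /(fractionM x)[]|x] //; first by left.
- right; exists u, v, v, x, (sv v); rewrite sv_star (letter_tgt lx).
  by split=> //; [exact: letter_word|exact: word_nil].
- move=> [->|[a [b [c [p [q [wp wq ->]]]]]]]; first by left; rewrite sg_star0.
  by right; exists b, a, c, q, p; rewrite sg_starM sg_starK.
Qed.

(** * Regularity and commuting idempotents *)

Lemma fraction_proj u v w p q : word u w p -> word v w q ->
  (p * q^*) * (p * q^*)^* = p * p^*.
Proof.
move=> wp wq; rewrite sg_starM sg_starK -sg_mulA (sg_mulA q^*) (word_iso wq).
by rewrite sg_mulA (word_tgt wp).
Qed.

Lemma sg_regular x : x * x^* * x = x.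
Proof.
have [->|[a [b [c [p [q [wp wq ->]]]]]]] := fractionP x; first by rewrite sg_mulr0.
rewrite (fraction_proj wp wq) -sg_mulA (sg_mulA p^*) (word_iso wp).
by rewrite sg_mulA (word_tgt wp).
Qed.

Definition projection x : Prop := x = 0 \/ exists u v p, word u v p /\ x = p * p^*.

Lemma mul_star_projection x : projection (x * x^*).
Proof.
have [->|[a [b [c [p [q [wp wq ->]]]]]]] := fractionP x.
  by left; rewrite sg_mul0.
by right; exists a, c, p; rewrite (fraction_proj wp wq).
Qed.

Lemma projection_star x : projection x -> x^* = x.
Proof.
by move=> [->|[u [v [p [_ ->]]]]]; rewrite ?sg_star0// sg_starM sg_starK.
Qed.

(** For f = q q^*, exchanging x with q gives x^* f x = q' q'^*, and the equation x q' = q x' moves f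
    past x. *)
Lemma projection_letter u v x (f : S) : letter u v x -> projection f ->
  projection (x^* * f * x) /\ f * x = x * (x^* * f * x).
Proof.
move=> lx [->|[a [b [q [wq ->]]]]];
  first by rewrite !(sg_mul0, sg_mulr0); split=> //; left.
have qxE : q^* * x = (x^* * q)^* by rewrite sg_starM sg_starK.
suff [xq0|[d [x' [q' [lx' wq' xqE xq]]]]] :
    x^* * q = 0 \/ exists d x' q', [/\ letter b d x', word v d q',
                                  x^* * q = q' * x'^* & x * q' = q * x'].
- by rewrite -!sg_mulA qxE xq0 sg_star0 !sg_mulr0; split=> //; left.
- have -> : x^* * (q * q^*) * x = q' * q'^*.
    by rewrite -!sg_mulA qxE sg_mulA xqE (fraction_proj wq' (letter_word lx')).
  split; first by right; exists v, d, q'.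
  by rewrite sg_mulA xq -!sg_mulA qxE xqE sg_starM sg_starK.
have [ua|ua] := pselect (u = a); last first.
  by left; exact: word_orth (letter_word lx) wq ua.
subst a. exact: (exchange_letter_word lx wq).
Qed.

Lemma projection_word u v p (f : S) : word u v p -> projection f ->
  f * p = p * (p^* * f * p).
Proof.
move=> wp; elim: wp f => [w|{}u w {}v x {}p lx _ IH] f projf.
  by have [_] := projection_letter (letter_vertex w) projf.
have [/IH{}IH fx] := projection_letter lx projf.
rewrite sg_mulA fx -!sg_mulA; congr (_ * _).
by rewrite !sg_mulA in IH *; rewrite IH sg_starM !sg_mulA.
Qed.

(** Write g = p p^*. Since f p = p (p^* f p), the product f g is self-adjoint, and its star is g
    f. *)
Lemma projection_comm (f g : S) : projection f -> projection g -> f * g = g * f.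
Proof.
move=> + [->|[u [v [p [wp ->]]]]]; first by rewrite sg_mul0 sg_mulr0.
move=> projf; have fpE := projection_word wp projf.
have sa : (f * (p * p^*))^* = f * (p * p^*).
  by rewrite sg_mulA fpE !(sg_starM, sg_starK) (projection_star projf) !sg_mulA.
by rewrite -sa !sg_starM sg_starK (projection_star projf).
Qed.

Lemma mul_star_comm x y : (x * x^*) * (y * y^*) = (y * y^*) * (x * x^*).
Proof. by apply: projection_comm; exact: mul_star_projection. Qed.

(** Regularity and the commutation of e e^* with e^* e show that e is the product of these two
    projections, hence self-adjoint. *)
Lemma idempotent_star (e : S) : e * e = e -> e^* = e.
Proof.
move=> ee; have eE : e = (e * e^*) * (e^* * e).
  have := mul_star_comm e e^*; rewrite sg_starK => comm.
  have : e * (e * e^* * (e^* * e)) * e = e * e^* * (e^* * e).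
    by rewrite !sg_mulA ee -(sg_mulA _ e e) ee.
  rewrite comm => <-.
  have -> : e * (e^* * e * (e * e^*)) * e = (e * e^* * e) * (e * e^* * e).
    by rewrite !sg_mulA.
  by rewrite sg_regular.
have := mul_star_comm e e^*; rewrite sg_starK => comm.
by rewrite [in LHS]eE !(sg_starM, sg_starK) -comm -eE.
Qed.

Lemma idempotent_mul_star (e : S) : e * e = e -> e = e * e^*.
Proof. by move=> ee; rewrite (idempotent_star ee). Qed.

Lemma idempotent_comm (e f : S) : e * e = e -> f * f = f -> e * f = f * e.
Proof.
move=> /idempotent_mul_star -> /idempotent_mul_star ->; exact: mul_star_comm.
Qed.

Lemma idempotentM (e f : S) : e * e = e -> f * f = f -> (e * f) * (e * f) = e * f.
Proof.
move=> ee ff; rewrite sg_mulA -(sg_mulA e f e) (idempotent_comm ff ee).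
by rewrite sg_mulA ee -sg_mulA ff.
Qed.

Lemma mul_star_idempotent (x : S) : (x * x^*) * (x * x^*) = x * x^*.
Proof. by rewrite sg_mulA sg_regular. Qed.

Lemma star_mul_idempotent (x : S) : (x^* * x) * (x^* * x) = x^* * x.
Proof. by have := mul_star_idempotent x^*; rewrite sg_starK. Qed.

End InverseSemigroup.

(** * The grading *)

Section Bijections.
Import GRing.Theory.
Local Open Scope ring_scope.

(** [Some (inl i)] records the exponent of alpha(p,i), [Some (inr i)] that of
    t_i, and [None] the number of edges which are not loops alpha(p,i). *)
Definition coord : Type := option (nat + nat).

(** A bijection of [coord -> int] paired with its inverse. *)
Definition coord_bij : Type :=
  ((coord -> int) -> (coord -> int)) * ((coord -> int) -> (coord -> int)).

Implicit Types (f g h : coord_bij) (m n : coord) (z : int).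

Definition bij_wf f : Prop := cancel f.1 f.2 /\ cancel f.2 f.1.

Definition bij_mul f g : coord_bij := (f.1 \o g.1, g.2 \o f.2).

Definition bij_inv f : coord_bij := (f.2, f.1).

Definition bij_one : coord_bij := (id, id).

Lemma bij_wf_mul f g : bij_wf f -> bij_wf g -> bij_wf (bij_mul f g).
Proof. by move=> [fK Kf] [gK Kg]; split=> x /=; rewrite ?gK ?fK// Kg. Qed.

Lemma bij_wf_inv f : bij_wf f -> bij_wf (bij_inv f).
Proof. by case. Qed.

Lemma bij_ext f g : bij_wf f -> bij_wf g -> f.1 =1 g.1 -> f = g.
Proof.
case: f g => [f f'] [g g'] [/= fK _] [/= _ Kg] /= fg; congr pair; apply/funext => //= x.
by rewrite -{1}[x]Kg -fg fK.
Qed.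

Definition add m z (x : coord -> int) : coord -> int :=
  fun n => x n + (if n == m then z else 0).

Lemma add_comm m n y z x : add m y (add n z x) = add n z (add m y x).
Proof. by apply/funext => i; rewrite /add addrAC. Qed.

Lemma addK m z : cancel (add m z) (add m (- z)).
Proof.
move=> x; apply/funext => n; rewrite /add -addrA; case: ifP => _; rewrite ?subrr ?addr0//.
Qed.

Definition shift m z : coord_bij := (add m z, add m (- z)).

Lemma shift_wf m z : bij_wf (shift m z).
Proof. by split; [exact: addK|move=> x; rewrite /= -{1}[z]opprK addK]. Qed.

(** The bijection of the coordinates matching (alpha_i)_(i <> j, i < k), (t_i)_i at
    the source of beta(p,j,s) with (t_i)_i at its range; the other coordinates are
    sent bijectively to the [Some (inl i)]. *)
Definition relabel (k j : nat) m : coord :=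
  match m with
  | None => None
  | Some (inl i) => if i == j then Some (inl 0%N)
                    else if (i < k)%N then Some (inr (unbump j i))
                    else Some (inl (i - k).+1)
  | Some (inr i) => Some (inr (i + k.-1)%N)
  end.

Definition unrelabel (k j : nat) m : coord :=
  match m with
  | None => None
  | Some (inl 0) => Some (inl j)
  | Some (inl i.+1) => Some (inl (i + k)%N)
  | Some (inr i) => if (i < k.-1)%N then Some (inl (bump j i))
                    else Some (inr (i - k.-1)%N)
  end.

Lemma unrelabelK k j : (j < k)%N -> cancel (unrelabel k j) (relabel k j).
Proof.
move=> jk [[[|i]|i]|] //=; first by rewrite eqxx.
- by rewrite gtn_eqF ?ltn_addl// ltnNge leq_addl /= addnK.
- case: ltnP => ik /=; last by rewrite subnK.
  rewrite eq_sym (negbTE (neq_bump _ _)) bumpK ifT//.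
  rewrite ltn_predRL in ik; apply: leq_ltn_trans ik.
  by rewrite /bump -add1n leq_add2r leq_b1.
Qed.

Lemma relabelK k j : (j < k)%N -> cancel (relabel k j) (unrelabel k j).
Proof.
move=> jk [[i|i]|] //=; last by rewrite ltnNge leq_addl /= addnK.
case: eqVneq => [->//|ij]; case: ltnP => ik /=; last by rewrite subnK.
rewrite unbumpK// ifT//.
(* Left to show: [unbump j i < k.-1]. An index below j is unchanged and j is at most k-1; an index
   above j drops by one. *)
case: k jk ik => // k jk ik /=; move: ij; rewrite neq_ltn /unbump => /orP[ij|ij].
  by rewrite [(j < i)%N]ltnNge (ltnW ij) subn0 (leq_trans ij).
by rewrite ij subn1; case: i ik ij.
Qed.

(** Exponents at the range of a beta become exponents at its source, so [relabel] acts by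
    precomposition; the beta itself is counted by the coordinate [None]. *)
Definition branch k j : coord_bij :=
  (fun x => add None 1 (x \o relabel k j), fun x => add None (-1) x \o unrelabel k j).

Lemma branch_wf k j : (j < k)%N -> bij_wf (branch k j).
Proof.
have unrelabelN m : (unrelabel k j m == None) = (m == None).
  by case: m => [[[|i]|i]|] //=; case: ifP.
move=> jk; split=> x; apply/funext => m; rewrite /= /add /=.
  by rewrite unrelabelN unrelabelK//; case: ifP => _; rewrite ?addr0 ?addrK.
by rewrite relabelK//; case: ifP => _; rewrite ?addr0 ?subrK.
Qed.

Lemma shift_comm m n y z :
  bij_mul (shift m y) (shift n z) = bij_mul (shift n z) (shift m y).
Proof.
by congr pair; apply/funext => x /=; rewrite add_comm.
Qed.

(** This is the image of R7 and R8 among bijections: a translation moved to the right of a beta has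
    its axis relabelled, and injectivity of [relabel] makes the axes match. *)
Lemma shift_branch k j m z : (j < k)%N ->
  bij_mul (shift m z) (branch k j) = bij_mul (branch k j) (shift (relabel k j m) z).
Proof.
move=> jk; apply: bij_ext => [||x /=];
  try (apply: bij_wf_mul; solve [exact: shift_wf|exact: branch_wf]).
rewrite add_comm; congr add; apply/funext => n; rewrite /add /=.
by rewrite (can_eq (relabelK jk)).
Qed.

End Bijections.

(** * Degrees of edges, terms and nonzero elements *)

Section Degree.
Variables (G : separated_graph) (A : adaptable G).
Local Notation S := (sgroup A).
Implicit Types (e f : edge G).

Definition alpha_index e (n : nat) : Prop :=
  exists p (i : 'I_(nblocks A p)), [/\ free A p, e = alpha i & n = i].

Definition beta_index e (n : nat) : Prop :=
  exists p (i : 'I_(nblocks A p)) (t : 'I_(nbeta i)),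
    [/\ free A p, e = beta t & n = i].

(** An edge does not carry its kind or index, so these are chosen classically; [edge_deg_alpha] and
    [edge_deg_beta] show that the choice is forced. A beta enters only through its block. *)
Definition edge_deg e : coord_bij :=
  match pselect (exists n, alpha_index e n) with
  | left h => shift (Some (inl (sval (cid h)))) 1%R
  | right _ =>
    match pselect (exists n, beta_index e n) with
    | left h => branch (nblocks A (comp_of (src e))) (sval (cid h))
    | right _ => shift None 1%R
    end
  end.

Lemma edge_deg_reg e : ~ free A (comp_of (src e)) -> edge_deg e = shift None 1%R.
Proof.
rewrite /edge_deg => re; case: pselect => [h|_].
  by exfalso; case: h => n [p [i [fp ei _]]];
    apply: re; rewrite ei src_alpha// comp_of_base.
case: pselect => [h|//].
by exfalso; case: h => n [p [i [t [fp et _]]]];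
  apply: re; rewrite et src_beta// comp_of_base.
Qed.

Lemma edge_deg_alpha p (i : 'I_(nblocks A p)) : free A p ->
  edge_deg (alpha i) = shift (Some (inl (i : nat))) 1%R.
Proof.
rewrite /edge_deg => fp; case: pselect => [h|[]]; last by exists i, p, i.
case: cid => /= n [q [j [fq ij ->]]].
have /(congr1 (@comp_of G)) : base A p = base A q
    by rewrite -(src_alpha i) // ij src_alpha.
by rewrite !comp_of_base// => pq; subst q; rewrite (alpha_inj fp ij).
Qed.

Lemma edge_deg_beta p (i : 'I_(nblocks A p)) (t : 'I_(nbeta i)) : free A p ->
  edge_deg (beta t) = branch (nblocks A p) i.
Proof.
move=> fp; rewrite /edge_deg src_beta// comp_of_base//.
case: pselect => [h|_]; last case: pselect => [h|[]]; last by exists i, p, i, t.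
  exfalso; case: h => n [q [j [fq ij _]]].
  have /(congr1 (@comp_of G)) : base A p = base A q
    by rewrite -(src_beta t) // ij src_alpha.
  rewrite !comp_of_base// => pq; subst q.
  by have := alpha_neq_beta fp (esym ij).
case: cid => /= n [q [j [s [fq ij ->]]]].
have /(congr1 (@comp_of G)) : base A p = base A q
    by rewrite -(src_beta t) // ij src_beta.
by rewrite !comp_of_base// => pq; subst q; rewrite (beta_block_inj fp ij).
Qed.

Lemma edge_deg_wf e : bij_wf (edge_deg e).
Proof.
have [re|p i fp ->|p i t fp ->] := edgeP A e.
- by rewrite edge_deg_reg//; exact: shift_wf.
- by rewrite edge_deg_alpha//; exact: shift_wf.
- by rewrite edge_deg_beta//; exact: branch_wf.
Qed.

Fixpoint term_deg (a : term G) : coord_bij :=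
  match a with
  | Tzero => bij_one
  | Tvertex _ => bij_one
  | Tedge e => edge_deg e
  | Tt _ i => shift (Some (inr i)) 1%R
  | Ttinv _ i => shift (Some (inr i)) (-1)%R
  | Tmul a b => bij_mul (term_deg a) (term_deg b)
  | Tstar a => bij_inv (term_deg a)
  end.

Lemma term_deg_wf a : bij_wf (term_deg a).
Proof.
elim: a => //= [e|_ i|_ i|a wa b wb|a wa]; try exact: shift_wf.
- exact: edge_deg_wf.
- exact: bij_wf_mul.
- exact: bij_wf_inv.
Qed.

Lemma term_deg_Ttpm b v i :
  term_deg (Ttpm b v i) = shift (Some (inr i)) (if b then -1 else 1)%R.
Proof. by case: b. Qed.

(** The first alternative covers the orthogonality relations; all others are identities between
    translations and branchings. *)
Lemma sg_rel_deg a b : sg_rel A a b -> b = Tzero \/ term_deg a = term_deg b.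
Proof.
have alphaE p (i : 'I_(nblocks A p)) : free A p ->
  bij_inv (edge_deg (alpha i)) = shift (Some (inl (i : nat))) (-1)%R.
  by move=> fp; rewrite edge_deg_alpha// /shift /bij_inv /= GRing.opprK.
have tE i : bij_mul (shift (Some (inr i)) 1%R) (shift (Some (inr i)) (-1)%R) = bij_one.
  by apply: bij_ext => [||x] //=; [apply: bij_wf_mul; exact: shift_wf|];
    rewrite -{1}[1%R]GRing.opprK addK.
case=> /= [v|v w _|v|e|e|v X e _ _|v X e f _ _ _ _|p i j fp _|p i j fp _|
           p i j s t _ _|v i j c d|v i|v i|v i|v i|v i|e i re|p j s i c fp|
           p i j s fp ij|p i j s fp ij|p i j fp|p i j fp];
  try by [left]; right=> //.
- by case: (edge_deg e).
- by case: (edge_deg e).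
- have wfe := edge_deg_wf e; apply: bij_ext => [|//|x /=]; last by case: wfe => ->.
  by apply: bij_wf_mul => //; exact: bij_wf_inv.
- by rewrite !edge_deg_alpha// shift_comm.
- by rewrite alphaE// edge_deg_alpha// shift_comm.
- by rewrite !term_deg_Ttpm shift_comm.
- by rewrite shift_comm tE.
- by rewrite edge_deg_reg// shift_comm.
- by rewrite edge_deg_beta// !term_deg_Ttpm shift_branch.
- rewrite edge_deg_beta// edge_deg_alpha// shift_branch//= ifN ?ltn_ord//.
  by apply/eqP => /val_inj.
- rewrite edge_deg_beta// alphaE// shift_branch//= ifN ?ltn_ord//.
  by apply/eqP => /val_inj.
- by rewrite edge_deg_alpha// shift_comm.
- by rewrite alphaE// shift_comm.
Qed.

(** Degrees can be compared only away from zero. As zero is absorbing, the alternative that both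
    sides vanish passes through every closure rule. *)
Lemma sg_cong_deg a b : sg_cong A a b ->
  sg_cong A a Tzero /\ sg_cong A b Tzero \/ term_deg a = term_deg b.
Proof.
elim=> {a b}.
- move=> a b ab; have [b0|] := sg_rel_deg ab; last by right.
  by left; rewrite -b0; split; [exact: cong_rel|exact: cong_refl].
- by right.
- by move=> a b _ [[]|]; [left|right].
- move=> a b c ab IHab bc IHbc.
  have [[a0 b0]|abE] := IHab.
    by left; split=> //; apply: cong_trans b0; apply: cong_sym.
  have [[b0 c0]|bcE] := IHbc; last by right; rewrite abE.
  by left; split=> //; apply: cong_trans b0.
- move=> a a' b b' _ IHa _ IHb.
  have zero_l c d : sg_cong A c Tzero -> sg_cong A (Tmul c d) Tzero.
    move=> c0; apply: cong_trans (cong_mul0 A d); apply: cong_mul c0 (cong_refl _ _).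
  have zero_r c d : sg_cong A d Tzero -> sg_cong A (Tmul c d) Tzero.
    move=> d0; apply: cong_trans (cong_mulr0 A c); apply: cong_mul d0; exact: cong_refl.
  have [[a0 a'0]|aE] := IHa; first by left; split; exact: zero_l.
  have [[b0 b'0]|bE] := IHb; first by left; split; exact: zero_r.
  by right; rewrite /= aE bE.
- move=> a b _ [[a0 b0]|abE]; last by right; rewrite /= abE.
  have star0 : sg_cong A (Tstar Tzero) Tzero.
    by apply/sg_classP; rewrite -sg_starE; exact: sg_star0.
  by left; split; apply: cong_trans star0; exact: cong_star.
- by right.
- by move=> a; right=> /=; case: (term_deg a).
- by right.
- by left; split; [exact: cong_mul0|exact: cong_refl].
- by left; split; [exact: cong_mulr0|exact: cong_refl].
Qed.

Local Open Scope sgroup_scope.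
Implicit Types (x y z : S).

(** Meaningful for nonzero elements only: the relations [... = 0] do not
    preserve [term_deg]. *)
Definition deg x : coord_bij := term_deg (class_repr x).

Lemma deg_class a : sg_class A a <> 0 -> deg (sg_class A a) = term_deg a.
Proof.
move=> a0; have [[_ /sg_classP//]|] := sg_cong_deg (sg_cong_repr A a).
by [].
Qed.

Lemma deg_wf x : bij_wf (deg x).
Proof. exact: term_deg_wf. Qed.

Lemma degM x y : x * y <> 0 -> deg (x * y) = bij_mul (deg x) (deg y).
Proof. exact: deg_class. Qed.

Lemma deg_star x : x^* <> 0 -> deg x^* = bij_inv (deg x).
Proof. exact: deg_class. Qed.

Lemma sg_mul_neq0 x y : x * y <> 0 -> x <> 0 /\ y <> 0.
Proof. by move=> xy; split=> z0; apply: xy; rewrite z0 ?sg_mul0 ?sg_mulr0. Qed.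

End Degree.

(** * Normal forms of words *)

Section NormalForm.
Import Order.TTheory GRing.Theory Num.Theory.
Variables (G : separated_graph) (A : adaptable G).
Local Notation S := (sgroup A).
Local Notation sv := (@sv G A).
Local Notation se := (@se G A).
Local Notation st := (@st G A).
Local Notation letter := (@letter G A).
Local Notation word := (@word G A).
Local Open Scope sgroup_scope.
Implicit Types (x y p q : S) (u v w : vertex G) (e f : edge G).

Lemma deg_mulI x p q : x * p <> 0 -> x * q <> 0 -> deg (x * p) = deg (x * q) ->
  deg p = deg q.
Proof.
move=> xp0 xq0; rewrite !degM// => -[pq _]; have [xK _] := deg_wf x.
apply: bij_ext (deg_wf p) (deg_wf q) _ => a; apply: (can_inj xK).
exact: (congr1 (fun h => h a) pq).
Qed.

(** * Exponents and products of commuting loops *)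

(** A degree need not be a translation, but its value at the origin still gives the number of steps
    of a word and, for a product of loops, all exponents. *)
Definition expo p (m : coord) : int := (deg p).1 (fun=> 0%R) m.

Lemma expo_vertex v : sv v <> 0 -> expo (sv v) =1 (fun=> 0%R).
Proof. by move=> v0 m; rewrite /expo deg_class. Qed.

(** [z] is the amount by which [x] raises the exponent [m] of the degree. *)
Inductive loop v : S -> coord -> int -> Prop :=
| loop_t b i : loop v (st b v i) (Some (inr i)) (if b then -1 else 1)%R
| loop_alpha r (i : 'I_(nblocks A r)) of free A r & v = base A r :
    loop v (se (alpha i)) (Some (inl (i : nat))) 1%R.

Lemma loop_letter v x m z : loop v x m z -> letter v v x.
Proof. by case=> [b i|r i fr ->]; [exact: letter_t|exact: letter_alpha]. Qed.

Lemma base_inj r r' : free A r -> free A r' -> base A r = base A r' -> r = r'.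
Proof. by move=> fr fr' /(congr1 (@comp_of G)); rewrite !comp_of_base. Qed.

Lemma loop_comm v x m z x' m' z' : loop v x m z -> loop v x' m' z' -> x * x' = x' * x.
Proof.
case=> [b i|r i fr vr] [c j|r' j fr' vr'].
- exact: st_comm.
- by rewrite vr' st_alpha.
- by rewrite vr st_alpha.
- have rr' : r = r' by apply: base_inj; rewrite -?vr.
  by subst r'; exact: alpha_comm.
Qed.

(** The axis separates alphas from t's and fixes the index, the sign tells t from its inverse, and v
    determines the free component. *)
Lemma loop_inj v x x' m z : loop v x m z -> loop v x' m z -> x = x'.
Proof.
move=> lx; move mE : m => m'; move zE : z => z' lx'.
case: lx' lx mE zE => [b i|r i fr vr] lx mE zE; case: lx mE zE => [c j|r' j fr' vr'] //.
  by move=> [<-]; case: b; case: c.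
have rr' : r = r' by apply: base_inj; rewrite -?vr.
by subst r' => -[/val_inj ->].
Qed.

Lemma loop_sign v x m z : loop v x m z -> z = 1%R \/ z = (-1)%R.
Proof. by case=> [[] i|]; [right|left|left]. Qed.

Lemma expo_loopM v x m z p n : loop v x m z -> x * p <> 0 ->
  expo (x * p) n = (expo p n + (if n == m then z else 0))%R.
Proof.
move=> lx xp0; rewrite /expo degM//= ; have [x0 _] := sg_mul_neq0 xp0.
case: lx x0 {xp0} => [b i|r i fr _] x0; rewrite deg_class//.
  by rewrite term_deg_Ttpm.
by rewrite /= edge_deg_alpha.
Qed.

Inductive loops v : nat -> S -> Prop :=
| loops_nil : loops v 0%N (sv v)
| loops_cons n x m z p of loop v x m z & loops v n p : loops v n.+1 (x * p).

Lemma loops_word v n p : loops v n p -> word v v p.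
Proof.
elim=> [|k x m z {}p lx _ wp]; first exact: word_nil.
exact: word_cons (loop_letter lx) wp.
Qed.

Lemma loops_neq0 v n p : sv v <> 0 -> loops v n p -> p <> 0.
Proof.
by move=> v0 /loops_word/word_iso pv p0; apply: v0; rewrite -pv p0 sg_mulr0.
Qed.

(** Inverses are available for the t's but not for the alphas. *)
Lemma expo_loops_alpha v n p i : sv v <> 0 -> loops v n p ->
  (0 <= expo p (Some (inl i)))%R.
Proof.
move=> v0; elim=> [|k x m z {}p lx lp IH]; first by rewrite expo_vertex.
rewrite (expo_loopM _ lx); last exact: loops_neq0 (loops_cons lx lp).
by apply: addr_ge0 => //; case: lx => [b j|r j _ _]; case: ifP => // /eqP[].
Qed.

(** An exponent with the sign of x can only come from a factor x, and loops commute, so this factor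
    can be brought to the front. *)
Lemma loops_extract v n p x m z : sv v <> 0 -> loops v n p -> loop v x m z ->
  (0 < z * expo p m)%R -> exists k q, [/\ n = k.+1, loops v k q & p = x * q].
Proof.
move=> v0 lp lx; elim: lp => [|k y m' z' {}p ly lp IH].
  by rewrite expo_vertex// mulr0.
rewrite (expo_loopM _ ly); last exact: loops_neq0 (loops_cons ly lp).
have [xy|xy] := pselect (x = y); first by rewrite -xy => _; exists k, p.
(* A first factor y other than x cannot push the exponent in the direction of x, by [loop_inj]. *)
have zz' : (z * (if m == m' then z' else 0) <= 0)%R.
  case: eqVneq => [mm'|_]; last by rewrite mulr0.
  case: (loop_sign lx) (loop_sign ly) => [zE|zE] [zE'|zE']; rewrite zE zE'//.
    by case: xy; apply: loop_inj lx _; rewrite zE mm' -zE'.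
  by case: xy; apply: loop_inj lx _; rewrite zE mm' -zE'.
rewrite mulrDr => zp; have {zp} : (0 < z * expo p m)%R.
  by apply: lt_le_trans zp _; rewrite gerDl.
move=> /IH[h [q [-> lq ->]]]; exists h.+1, (y * q); split=> //.
  exact: loops_cons ly lq.
by rewrite !sg_mulA (loop_comm lx ly).
Qed.

(** The exponent of the first factor must be compensated by the rest. For an alpha this is
    impossible; for a t its inverse occurs further on, and cancelling the pair leaves two factors
    fewer, whence the strong induction. *)
Lemma loops_deg1 v n p : sv v <> 0 -> loops v n p -> deg p = deg (sv v) -> p = sv v.
Proof.
move=> v0; have [k] := ubnP n; elim: k n p => // k IH n p nk lp.
case: lp nk => // h x m z {}p lx lp hk pv.
have xp0 := loops_neq0 v0 (loops_cons lx lp).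
have : expo (x * p) m = 0%R by rewrite /expo pv -/(expo _ m) expo_vertex.
rewrite (expo_loopM _ lx)// eqxx => /eqP; rewrite addr_eq0 => /eqP.
case: lx xp0 pv => [b i|r i _ _] xp0 pv pE; last first.
  by have := expo_loops_alpha i v0 lp; rewrite pE.
have lV := loop_t v (~~ b) i.
have [|g [q [hE lq pq]]] := loops_extract v0 lp lV; first by rewrite pE; case: (b).
have xpq : st b v i * p = q.
  by rewrite pq sg_mulA st_mulV (word_src (loops_word lq)).
rewrite xpq; apply: IH lq _; last by rewrite -xpq.
by rewrite hE in hk; exact: ltnW hk.
Qed.

(** The first factor of q is split off p as well: a t by inserting its inverse, which may lengthen
    p, and an alpha because its exponent in p is positive. *)
Lemma loops_deg_inj v n k p q : sv v <> 0 -> loops v n p -> loops v k q ->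
  deg p = deg q -> p = q.
Proof.
move=> v0 + lq; elim: lq n p => [|{}k x m z {}q lx lq IH] n p lp pq.
  exact: loops_deg1 lp pq.
have xq0 := loops_neq0 v0 (loops_cons lx lq).
case: lx xq0 pq => [b i|r i fr vr] xq0 pq.
  have lV := loop_t v (~~ b) i; have lVp := loops_cons lV lp.
  have pE : p = st b v i * (st (~~ b) v i * p).
    by rewrite sg_mulA st_mulV (word_src (loops_word lp)).
  rewrite pE; congr (_ * _); apply: IH lVp _.
  by apply: deg_mulI xq0 _; rewrite -?pE//; exact: loops_neq0 lp.
have lx := loop_alpha i fr vr.
have [|h [p' [_ lp' pE]]] := loops_extract v0 lp lx.
  rewrite mul1r /expo pq -/(expo _ _) (expo_loopM _ lx)// eqxx ltr_wpDl//.
  exact: expo_loops_alpha lq.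
rewrite pE; congr (_ * _); apply: IH lp' _.
by apply: deg_mulI xq0 _; rewrite -?pE//; exact: loops_neq0 lp.
Qed.

(** * Existence of normal forms *)

(** This is alpha(r,j)^a beta(r,j,s) p. Alphas of other blocks pass the beta as t's, so only those
    of its own block stay on the left. *)
Definition branch_word r (j : 'I_(nblocks A r)) (s : 'I_(nbeta j)) (a : nat) p : S :=
  iter a (sg_mul (se (alpha j))) (se (beta s) * p).

(** Loops are pushed to the right as far as they go: what remains is a sequence of steps followed by
    loops at the last vertex. *)
Inductive nf : vertex G -> S -> Prop :=
| nf_loops v n p of loops v n p : nf v p
| nf_reg e p of ~ free A (comp_of (src e)) & nf (tgt e) p : nf (src e) (se e * p)
| nf_branch r (j : 'I_(nblocks A r)) (s : 'I_(nbeta j)) a p of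
    free A r & nf (tgt (beta s)) p : nf (base A r) (branch_word s a p).

Lemma branch_word_src r (j : 'I_(nblocks A r)) (s : 'I_(nbeta j)) a p : free A r ->
  sv (base A r) * branch_word s a p = branch_word s a p.
Proof.
move=> fr; case: a => [|a]; rewrite /branch_word /=.
  by rewrite -(src_beta s fr) (sg_mulKA _ (se_src A _)).
by rewrite -(src_alpha j fr) (sg_mulKA _ (se_src A _)).
Qed.

Lemma nf_src v p : nf v p -> sv v * p = p.
Proof.
case=> [{}v n {}p /loops_word/word_src//|e {}p _ _|r j s a {}p fr _].
  by rewrite (sg_mulKA _ (se_src A _)).
exact: branch_word_src.
Qed.

Lemma iter_mul_comm x y a p : x * y = y * x ->
  x * iter a (sg_mul y) p = iter a (sg_mul y) (x * p).
Proof. by move=> xy; elim: a => //= a <-; rewrite !sg_mulA xy. Qed.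

Lemma nf_t v p b i : nf v p -> nf v (st b v i * p).
Proof.
move=> np; elim: np i => [{}v n {}p lp|e {}p re _ IH|r j s a {}p fr _ IH] i.
- exact: nf_loops (loops_cons (loop_t v b i) lp).
- by rewrite sg_mulA (st_reg _ _ re) -sg_mulA; exact: nf_reg.
- rewrite /branch_word iter_mul_comm; last exact: st_alpha.
  by rewrite (sg_mulKA _ (st_beta _ _ _ fr)) -sg_mulA; exact: nf_branch.
Qed.

(** In front of a branching, an alpha of the same block raises the power; any other one passes the
    beta, becomes a t, and is absorbed by [nf_t]. *)
Lemma nf_alpha r (i : 'I_(nblocks A r)) p : free A r -> nf (base A r) p ->
  nf (base A r) (se (alpha i) * p).
Proof.
move=> fr; move vE : (base A r) => v np.
case: np vE => [{}v n {}p lp|e {}p re _|r' j s a {}p fr' np] vE.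
- by apply: nf_loops (loops_cons (loop_alpha i fr _) lp).
- by case: re; rewrite -vE comp_of_base.
- have rr' := base_inj fr fr' vE; subst r'.
  have [<-|/eqP ij] := eqVneq j i; first exact: (@nf_branch _ j s a.+1).
  rewrite /branch_word iter_mul_comm; last exact: alpha_comm.
  rewrite (sg_mulKA _ (alpha_beta _ fr _)); last by move=> ji; apply: ij.
  by rewrite -sg_mulA; apply: nf_branch => //; exact: nf_t.
Qed.

Lemma word_nf u v p : word u v p -> nf u p.
Proof.
elim=> [w|{}u w {}v x {}p lx _ np]; first exact: nf_loops (loops_nil w).
case: lx np => [a|e|b a i] np; first by rewrite nf_src.
  have [re|r i fr eE|r i t fr eE] := edgeP A e.
  - exact: nf_reg.
  - by rewrite eE src_alpha//; apply: nf_alpha => //; rewrite -(tgt_alpha i fr) -eE.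
  - by rewrite eE src_beta//; apply: (@nf_branch _ i t 0%N) => //; rewrite -eE.
exact: nf_t.
Qed.

(** * Counting steps by the coordinate [None] *)

Lemma expo_alphaM r (j : 'I_(nblocks A r)) p : free A r ->
  se (alpha j) * p <> 0 -> expo (se (alpha j) * p) None = expo p None.
Proof.
move=> fr ap0; rewrite (expo_loopM _ (loop_alpha j fr (erefl _)))//.
by rewrite addr0.
Qed.

(** Regular edges and betas both add one to [None], which [relabel] fixes. *)
Lemma expo_step e p : (forall r (i : 'I_(nblocks A r)), free A r -> e <> alpha i) ->
  se e * p <> 0 -> expo (se e * p) None = (expo p None + 1)%R.
Proof.
move=> ne ep0; rewrite /expo degM//=; have [e0 _] := sg_mul_neq0 ep0.
rewrite deg_class//=; have [re|r i fr eE|r i t fr ->] := edgeP A e.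
- by rewrite edge_deg_reg.
- by case: (ne r i fr).
- by rewrite edge_deg_beta.
Qed.

Lemma beta_neq_alpha r (j : 'I_(nblocks A r)) (s : 'I_(nbeta j)) : free A r ->
  forall r' (i : 'I_(nblocks A r')), free A r' -> beta s <> alpha i.
Proof.
move=> fr r' i fr' bi; have rr' : r = r'.
  by apply: base_inj => //; rewrite -(src_beta s fr) bi src_alpha.
by subst r'; exact: alpha_neq_beta (esym bi).
Qed.

Lemma reg_neq_alpha e : ~ free A (comp_of (src e)) ->
  forall r (i : 'I_(nblocks A r)), free A r -> e <> alpha i.
Proof. by move=> re r i fr ei; apply: re; rewrite ei src_alpha// comp_of_base. Qed.

Lemma expo_branch_word r (j : 'I_(nblocks A r)) (s : 'I_(nbeta j)) a p : free A r ->
  branch_word s a p <> 0 -> expo (branch_word s a p) None = (expo p None + 1)%R.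
Proof.
move=> fr; elim: a => [|a IH] b0; first by apply: expo_step => //; exact: beta_neq_alpha.
by rewrite [LHS]expo_alphaM// IH//; have [] := sg_mul_neq0 b0.
Qed.

Lemma expo_loops_None v n p : sv v <> 0 -> loops v n p -> expo p None = 0%R.
Proof.
move=> v0; elim=> [|k x m z {}p lx lp IH]; first by rewrite expo_vertex.
rewrite (expo_loopM _ lx); last exact: loops_neq0 (loops_cons lx lp).
by rewrite IH add0r; case: lx.
Qed.

Lemma nf_vertex_neq0 v p : nf v p -> p <> 0 -> sv v <> 0.
Proof. by move=> /nf_src vp p0 v0; apply: p0; rewrite -vp v0 sg_mul0. Qed.

Lemma expo_nf_None v p : nf v p -> p <> 0 -> (0 <= expo p None)%R.
Proof.
elim=> [{}v n {}p lp p0|e {}p re _ IH ep0|r j s a {}p fr _ IH bp0].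
- by rewrite (expo_loops_None _ lp)//; exact: nf_vertex_neq0 (nf_loops lp) p0.
- rewrite (expo_step (reg_neq_alpha re))// addr_ge0//; apply: IH.
  by have [] := sg_mul_neq0 ep0.
- rewrite expo_branch_word// addr_ge0//; apply: IH => p0; apply: bp0.
  by rewrite /branch_word p0 sg_mulr0; elim: a => //= a ->; rewrite sg_mulr0.
Qed.

(** * Comparison of first steps and uniqueness of normal forms *)

(** Each alpha of one side passes the alphas and the beta of the other and ends as a t inside the
    tail; p and q are arbitrary, so the tails absorb it. Finally two distinct betas meet and give
    zero. *)
Lemma branch_word_orth r (i j : 'I_(nblocks A r)) (s : 'I_(nbeta i))
    (t : 'I_(nbeta j)) a b p q : free A r -> i <> j ->
  (branch_word s a p)^* * branch_word t b q = 0.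
Proof.
move=> fr ij; have ji : j <> i by move=> ji; apply: ij.
have bst : beta s <> beta t by move=> /(beta_block_inj fr).
elim: a q => [|a IH] q.
  elim: b p => [|b IH] p; rewrite /branch_word /=.
    by rewrite sg_starM -!sg_mulA (sg_mulKA _ (beta_orth_neq fr bst)) sg_mul0 sg_mulr0.
  rewrite sg_mulA -{1}(sg_starK (se (alpha j))) -sg_starM sg_mulA alpha_star_beta//.
  by rewrite -sg_mulA; exact: IH.
rewrite /branch_word /= sg_starM -sg_mulA iter_mul_comm; last exact: alpha_star_comm.
rewrite (sg_mulKA _ (alpha_star_beta _ fr ij)) -sg_mulA.
exact: IH.
Qed.

Lemma star_mul_cancel x v p q : x^* * x = sv v -> sv v * q = q ->
  (x * p)^* * (x * q) = p^* * q.
Proof. by move=> xx vq; rewrite sg_starM -sg_mulA (sg_mulKA _ xx) vq. Qed.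

(** Common alphas cancel; a surplus alpha would meet a beta of its own block, and distinct betas are
    orthogonal. *)
Lemma branch_word_match r (j : 'I_(nblocks A r)) (s t : 'I_(nbeta j)) a b p q :
  free A r -> (branch_word s a p)^* * branch_word t b q <> 0 ->
  a = b /\ beta s = beta t.
Proof.
move=> fr; elim: a b => [|a IH] [|b].
- have [->//|st] := pselect (beta s = beta t); case.
  rewrite /branch_word /= sg_starM -!sg_mulA.
  by rewrite (sg_mulKA _ (beta_orth_neq fr st)) sg_mul0 sg_mulr0.
- case; rewrite /branch_word /= sg_mulA -{1}(sg_starK (se (alpha j))) -sg_starM.
  by rewrite (sg_mulKA _ (alpha_beta_orth _ fr)) sg_mul0 sg_star0 sg_mul0.
- case; rewrite /branch_word /= sg_starM -sg_mulA.
  by rewrite (sg_mulKA _ (alpha_beta_orth _ fr)) sg_mul0 sg_mulr0.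
- rewrite [_ * branch_word t _ _](star_mul_cancel _ (alpha_iso j fr)).
    by move=> /IH[-> ->].
  exact: branch_word_src.
Qed.

Lemma deg_star_cancel x v p q : x^* * x = sv v -> sv v * p = p ->
  (x * q)^* * (x * p) <> 0 -> deg (x * p) = deg (x * q) ->
  q^* * p <> 0 /\ deg p = deg q.
Proof.
move=> xx vp qp0 pq; rewrite -(star_mul_cancel _ xx vp); split=> //.
have [xq0 xp0] := sg_mul_neq0 qp0; apply: deg_mulI pq => //.
by move=> q0; apply: xq0; rewrite q0 sg_star0.
Qed.

Lemma branch_word_cancel r (j : 'I_(nblocks A r)) (s : 'I_(nbeta j)) a p q :
  free A r -> sv (tgt (beta s)) * p = p ->
  (branch_word s a q)^* * branch_word s a p <> 0 ->
  deg (branch_word s a p) = deg (branch_word s a q) ->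
  q^* * p <> 0 /\ deg p = deg q.
Proof.
move=> fr sp; elim: a => [|a IH] qp0 pq.
  exact: deg_star_cancel (se_iso _ _) sp qp0 pq.
have [] := deg_star_cancel (alpha_iso j fr) (branch_word_src _ _ _ fr) qp0 pq.
exact: IH.
Qed.

Lemma expo_reg_gt0 e p : ~ free A (comp_of (src e)) -> nf (tgt e) p ->
  se e * p <> 0 -> (0 < expo (se e * p)%sg None)%R.
Proof.
move=> re np ep0; rewrite (expo_step (reg_neq_alpha re))// ltzD1.
by apply: expo_nf_None np _; have [] := sg_mul_neq0 ep0.
Qed.

Lemma branch_word_neq0 r (j : 'I_(nblocks A r)) (s : 'I_(nbeta j)) a p :
  branch_word s a p <> 0 -> p <> 0.
Proof.
move=> + p0; apply; rewrite /branch_word p0 sg_mulr0.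
by elim: a => //= a ->; rewrite sg_mulr0.
Qed.

Lemma expo_branch_gt0 r (j : 'I_(nblocks A r)) (s : 'I_(nbeta j)) a p : free A r ->
  nf (tgt (beta s)) p -> branch_word s a p <> 0 ->
  (0 < expo (branch_word s a p) None)%R.
Proof.
move=> fr np bp0; rewrite expo_branch_word// ltzD1.
exact: expo_nf_None np (branch_word_neq0 bp0).
Qed.

(** The number of steps is the exponent [None] of the degree, so the two normal
    forms have the same length; since [q^* p] is nonzero, their first steps agree. *)
Lemma nf_deg_inj v p q : nf v p -> nf v q -> q^* * p <> 0 -> deg p = deg q -> p = q.
Proof.
move=> np; elim: np q => [{}v n {}p lp|e {}p re np IH|r j s a {}p fr np IH] q nq qp0 pq.
all: have [sq0 p0] := sg_mul_neq0 qp0.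
all: have q0 : q <> 0 by move=> q0; apply: sq0; rewrite q0 sg_star0.
all: have expoE := congr1 (fun h : coord_bij => h.1 (fun=> 0%R) None) pq.
all: rewrite -!/(expo _ None) in expoE.
(* Here p has no steps, so its exponent at [None] is zero and q has none either: both are products
   of loops. *)
- have v0 := nf_vertex_neq0 (nf_loops lp) p0.
  rewrite (expo_loops_None v0 lp) in expoE.
  case: nq lp q0 v0 expoE pq {qp0 sq0} => [w k {}q lq|e {}q re nq|r j s a {}q fr nq]
    lp q0 v0 expoE pq.
  + exact: loops_deg_inj v0 lp lq pq.
  + by have := expo_reg_gt0 re nq q0; rewrite -expoE.
  + by have := expo_branch_gt0 fr nq q0; rewrite -expoE.
- have := expo_reg_gt0 re np p0; rewrite expoE => {expoE} expoq.
  move vE : (src e) nq => v' nq.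
  case: nq vE q0 qp0 sq0 expoq pq => [w k {}q lq|f {}q rf nq|r j s a {}q fr nq]
    vE q0 qp0 sq0 expoq pq.
  + by rewrite (expo_loops_None _ lq) in expoq;
      last exact: nf_vertex_neq0 (nf_loops lq) q0.
  + have fe : f = e.
      apply: contrapT => fe; apply: qp0; rewrite sg_starM -sg_mulA.
      by rewrite (sg_mulKA _ (reg_edge_orth rf (esym vE) fe)) sg_mul0 sg_mulr0.
    subst f; have [q1p1 pq1] := deg_star_cancel (se_iso _ e) (nf_src np) qp0 pq.
    by rewrite (IH q).
  + by case: re; rewrite vE comp_of_base.
- have := expo_branch_gt0 fr np p0; rewrite expoE => {expoE} expoq.
  move vE : (base A r) nq => v' nq.
  case: nq vE q0 qp0 sq0 expoq pq => [w k {}q lq|f {}q rf nq|r' i t b {}q fr' nq]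
    vE q0 qp0 sq0 expoq pq.
  + by rewrite (expo_loops_None _ lq) in expoq;
      last exact: nf_vertex_neq0 (nf_loops lq) q0.
  + by case: rf; rewrite -vE comp_of_base.
  + have rr' := base_inj fr fr' vE; subst r'.
    have [ij|/eqP ij] := eqVneq i j; last by case: qp0; exact: branch_word_orth.
    subst i; have [ba ts] := branch_word_match fr qp0; subst b.
    have btE : branch_word t a q = branch_word s a q by rewrite /branch_word ts.
    rewrite btE in qp0 pq *; rewrite ts in nq.
    have [q1p1 pq1] := branch_word_cancel fr (nf_src np) qp0 pq.
    by rewrite (IH q).
Qed.

(** This is E*-unitarity. Cancelling the degree of f shows that s has trivial degree, so p and q
    have equal degrees when s = p q^*. As s s fixes f, it is nonzero, and s s = p (q^* p) q^* shows
    that q^* p is nonzero. *)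
Lemma idempotent_above (s f : S) : f * f = f -> f <> 0 -> s * f = f -> s * s = s.
Proof.
move=> ff f0 sf.
have ss0 : s * s <> 0 by move=> ss0; apply: f0; rewrite -sf -sf sg_mulA ss0 sg_mul0.
have deg_s : (deg s).1 =1 id.
  move=> x; have [_ fK] := deg_wf f; rewrite -[in LHS](fK x).
  have sf0 : s * f <> 0 by rewrite sf.
  have := congr1 (fun h : coord_bij => h.1 ((deg f).2 x)) (degM sf0).
  by rewrite sf /= => <-; rewrite fK.
have [s0|[u [v [w [p [q [wp wq sE]]]]]]] := fractionP s; first by rewrite s0 sg_mul0.
have qp0 : q^* * p <> 0.
  move=> qp; apply: ss0.
  by rewrite sE -sg_mulA (sg_mulA q^*) qp sg_mul0 sg_mulr0.
have uv : u = v.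
  apply: contrapT => uv; apply: qp0; by apply: word_orth wq wp _ => vu; apply: uv.
subst v; have pq : deg p = deg q.
  have s0 : p * q^* <> 0 by rewrite -sE => s0; apply: ss0; rewrite s0 sg_mul0.
  have [_ sq0] := sg_mul_neq0 s0.
  apply: bij_ext (deg_wf p) (deg_wf q) _ => x; have [qK Kq] := deg_wf q.
  by have := deg_s ((deg q).1 x); rewrite sE degM//= deg_star//= qK.
rewrite sE (nf_deg_inj (word_nf wp) (word_nf wq) qp0 pq); exact: mul_star_idempotent.
Qed.

End NormalForm.

(** * Separation of germs *)

Section Hausdorff.
Variables (G : separated_graph) (A : adaptable G).
Local Notation S := (sgroup A).
Local Open Scope sgroup_scope.
Implicit Types (s t e f : S) (x y z : tight_spectrum A) (g h : tight_groupoid A).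

Lemma spectrum_filter x : is_filter (val x).
Proof. by case: x => X /= /set_mem[]. Qed.

Lemma spectrum_idempotent x e : val x e -> e * e = e.
Proof. by have [xE _ _ _ _] := spectrum_filter x; move=> /xE. Qed.

Lemma spectrum_mul x e f : val x e -> val x f -> val x (e * f).
Proof. by have [_ _ _ xM _] := spectrum_filter x; exact: xM. Qed.

Lemma spectrum_neq0 x e : val x e -> e <> 0.
Proof.
by have [_ _ x0 _ _] := spectrum_filter x; move=> xe e0; apply: x0; rewrite -e0.
Qed.

Lemma spectrum_up x e f : val x e -> f * f = f -> e * f = e -> val x f.
Proof. by have [_ _ _ _ xU] := spectrum_filter x; exact: xU. Qed.

(** Membership of an idempotent is a coordinate of the product, hence continuous into the discrete
    space [bool]. *)
Lemma tight_dom_preimage e (B : set bool) : e * e = e ->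
  open [set x : tight_spectrum A | B `[< val x e >]].
Proof.
move=> ee; have eI : e \in @idempotents G A by exact: mem_set.
pose ev (F : {ptws set_type (@idempotents G A) -> bool}) := F (exist _ e eI).
have -> : [set x : tight_spectrum A | B `[< val x e >]] =
          (ev \o @filter_char G A) @^-1` B by [].
apply: open_comp; last exact: discrete_open.
move=> x _; apply: continuous_comp; first exact: initial_continuous.
exact: (@proj_continuous _ _ (exist _ e eI)).
Qed.

Lemma open_tight_dom e : open (tight_dom e).
Proof.
have [ee|nee] := pselect (e * e = e).
  rewrite (_ : tight_dom e = [set x : tight_spectrum A | [set true] `[< val x e >]]).
    exact: tight_dom_preimage.
  by apply/seteqP; split=> x /= /asboolP.
rewrite (_ : tight_dom e = set0); first exact: open0.
by apply/seteqP; split=> // x /spectrum_idempotent.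
Qed.

(** The element e is arbitrary because this serves for [t^* * s], which may fail to be idempotent;
    it then belongs to no filter. *)
Lemma open_tight_domC e : open (~` tight_dom e).
Proof.
have [ee|nee] := pselect (e * e = e).
  rewrite (_ : ~` tight_dom e = [set x : tight_spectrum A | [set false] `[< val x e >]]).
    exact: tight_dom_preimage.
  apply/seteqP; split=> x /=; first by move=> /asboolPn/negbTE.
  by move=> xe /asboolP; rewrite xe.
rewrite (_ : ~` tight_dom e = setT); first exact: openT.
by apply/seteqP; split=> // x _ /spectrum_idempotent.
Qed.

Lemma open_Theta s (U : set (tight_spectrum A)) : open U ->
  U `<=` tight_dom (s^* * s) -> open (Theta s U).
Proof.
move=> oU sU; exists [set Theta s U]; last by rewrite bigcup_set1.
by move=> _ ->; apply: finI_from1; exists s, U.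
Qed.

Lemma same_germ_sym (a b : S * tight_spectrum A) : same_germ a b -> same_germ b a.
Proof.
by case=> ab [f [ff xf] E]; split=> //; exists f => //; rewrite -ab.
Qed.

Lemma same_germ_trans (a b c : S * tight_spectrum A) :
  same_germ a b -> same_germ b c -> same_germ a c.
Proof.
case: a b c => [a x] [b y] [c w] [/= <- {y} [e [ee xe] abE]] [/= <- {w} [f [ff xf] bcE]].
split=> //=; exists (e * f).
  by split; [exact: idempotentM|exact: spectrum_mul].
by rewrite sg_mulA abE -sg_mulA (idempotent_comm ee ff) !sg_mulA bcE.
Qed.

Lemma germ_eq s t x : same_germ (s, x) (t, x) -> germ s x = germ t x.
Proof.
move=> st; apply/seteqP; split=> b [gb sb]; split=> //.
  exact: same_germ_trans (same_germ_sym st) sb.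
exact: same_germ_trans st sb.
Qed.

Lemma germ_inj s t x y : tight_dom (t^* * t) y -> germ s x = germ t y ->
  same_germ (s, x) (t, y).
Proof.
move=> yt st; suff : germ s x (t, y) by case.
rewrite st; split=> //; split=> //; exists (t^* * t) => //.
by split=> //; exact: star_mul_idempotent.
Qed.

(** The forward direction is where E*-unitarity is used. *)
Lemma same_germ_star_mul s t x : val x (s^* * s) -> val x (t^* * t) ->
  same_germ (s, x) (t, x) <-> val x (t^* * s).
Proof.
move=> xs xt; split=> [[_ [f [ff xf] /= stf]]|xts].
  have xtf := spectrum_mul xt xf.
  (* Thus [t^* * s] lies above the nonzero idempotent [t^* * t * f] of x. *)
  have tsf : t^* * s * (t^* * t * f) = t^* * t * f.
    rewrite (idempotent_comm (star_mul_idempotent t) ff) sg_mulA -(sg_mulA t^*) stf.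
    rewrite (sg_mulA t^*) -sg_mulA (idempotent_comm ff (star_mul_idempotent t)).
    by rewrite !sg_mulA -(sg_mulA _ t^* t) star_mul_idempotent.
  have ee := idempotentM (star_mul_idempotent t) ff.
  have ts := idempotent_above ee (spectrum_neq0 xtf) tsf.
  by apply: (spectrum_up xtf ts); rewrite (idempotent_comm ee ts).
have ee := spectrum_idempotent xts; split=> //=; exists (t^* * s) => //.
(* As an idempotent, t^* s equals s^* t t^* s. Hence s t^* s = s s^* t t^* s, and commuting the two
   projections turns this into t t^* s. *)
rewrite -{1}ee -{1}(idempotent_star ee) sg_starM sg_starK.
have -> : s * (s^* * t * (t^* * s)) = s * s^* * (t * t^*) * s by rewrite !sg_mulA.
by rewrite mul_star_comm -sg_mulA sg_regular sg_mulA.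
Qed.

Lemma spectrum_separated x y : x <> y -> exists e,
  val x e /\ ~ val y e \/ val y e /\ ~ val x e.
Proof.
move=> xy; apply: contrapT => sep; apply: xy; apply: val_inj; apply/seteqP.
by split=> e xe; apply: contrapT => ye; apply: sep; exists e; [left|right].
Qed.

Lemma Theta_disjoint_spectrum s t (U V : set (tight_spectrum A)) :
  U `<=` tight_dom (s^* * s) -> V `<=` tight_dom (t^* * t) ->
  (forall x, U x -> V x -> ~ same_germ (s, x) (t, x)) ->
  Theta s U `&` Theta t V = set0.
Proof.
move=> sU tV UV; apply/seteqP; split=> // g [[x Ux gx] [y Vy gy]].
have st : same_germ (s, x) (t, y) by apply: germ_inj; [exact: tV|rewrite -gx].
by have [/= xy _] := st; subst y; exact: (UV x Ux Vy).
Qed.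

Lemma groupoid_separated g h : g <> h -> exists U V : set (tight_groupoid A),
  [/\ open U, open V, U g, V h & U `&` V = set0].
Proof.
have [[s x] /= sx gE] := set_mem (valP g); have [[t y] /= ty hE] := set_mem (valP h).
move=> gh.
(* It suffices to separate in the spectrum: intersecting with the domains of s and t gives basic
   open sets of germs. *)
suff [U [V [oU oV [Ux Vy] UV]]] : exists U V : set (tight_spectrum A),
    [/\ open U, open V, U x /\ V y & forall z, U z -> V z ->
      val z (s^* * s) -> val z (t^* * t) -> ~ same_germ (s, z) (t, z)].
  exists (Theta s (U `&` tight_dom (s^* * s))), (Theta t (V `&` tight_dom (t^* * t))).
  split.
  - by apply: open_Theta; [apply: openI => //; exact: open_tight_dom|move=> ? []].
  - by apply: open_Theta; [apply: openI => //; exact: open_tight_dom|move=> ? []].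
  - by exists x.
  - by exists y.
  - by apply: Theta_disjoint_spectrum => [? []//|? []//|z [Uz sz] [Vz tz]]; exact: UV.
have [xy|xy] := pselect (x = y).
  (* Over a common base point the germs differ because [t^* * s] is not in x, and they stay
     different wherever it is absent. *)
  subst y; exists (~` tight_dom (t^* * s)), setT; split.
  - exact: open_tight_domC.
  - exact: openT.
  - split=> //= xts; apply: gh; apply: val_inj.
    by apply: etrans (esym gE) _; apply: etrans hE; apply/germ_eq/same_germ_star_mul.
  - by move=> z zts _ zs zt /(same_germ_star_mul zs zt).
(* Different base points are told apart by a clopen set [tight_dom e]. *)
have [e [[xe ye]|[ye xe]]] := spectrum_separated xy.
  exists (tight_dom e), (~` tight_dom e); split=> //.
  - exact: open_tight_dom.
  - exact: open_tight_domC.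
exists (~` tight_dom e), (tight_dom e); split=> //.
- exact: open_tight_domC.
- exact: open_tight_dom.
Qed.

End Hausdorff.

Theorem corollary2p21 (G : separated_graph) (A : adaptable G) :
  hausdorff_space (tight_groupoid A).
Proof.
rewrite open_hausdorff => g h /eqP /groupoid_separated[U [V [oU oV Ug Vh UV]]].
exists (U, V); first by split; exact: mem_set.
by split=> //=; exact/eqP.
Qed.
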